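(* Let $p$ be a prime number. For any integer $n \ge 3$, we have $$\dim \{ \xi \in \mathbb{Q}_p : \lambda_n (\xi) \ge 1/3 \} \ge \frac{2}{(n - 1) (1 + 1/3)}.$$
   Context: $|\cdot|_p$ is the usual $p$-adic absolute value on $\mathbb{Q}_p$, normalized by $|p|_p=p^{-1}$, and $\dim$ denotes Hausdorff dimension in $\mathbb{Q}_p$ for the metric $|x-y|_p$. For an integer $n\ge 1$ and $\xi\in\mathbb{Q}_p$, $\lambda_n(\xi)\in[-\infty,+\infty]$ denotes the supremum of the real numbers $\lambda$ such that, for arbitrarily large real numbers $X$, the inequalities $$\max\{|x_0|,\ldots,|x_n|\}\le X,\qquad 0<\max_{1\le m\le n}|x_0\xi^m-x_m|_p\le X^{-\lambda-1}$$ have a solution in integers $x_0,\ldots,x_n$. *)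

(* Defs.v *)
From HB Require Import structures.
From mathcomp Require Import all_boot all_order all_algebra.
From mathcomp Require Import generic_quotient ring_quotient.
From mathcomp Require Import zify ring.
From mathcomp Require Import all_classical all_reals all_analysis.

Set Implicit Arguments.
Unset Strict Implicit.
Unset Printing Implicit Defensive.

Import Order.TTheory GRing.Theory Num.Theory.
Import numFieldNormedType.Exports.

Local Open Scope classical_set_scope.
Local Open Scope ring_scope.
Local Open Scope quotient_scope.

(* If p is not prime, logn p is identically 0 and this is the trivial absolute
   value, so the construction of Q_p below needs no primality hypothesis. *)
Definition padic_abs (R : realType) (p : nat) (q : rat) : R :=
  if q == 0 then 0
  else p%:R ^ ((logn p `|denq q|%N)%:Z - (logn p `|numq q|%N)%:Z).

Section PadicAbs.
Context (R : realType) (p : nat).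
Local Notation abs := (@padic_abs R p).

Let logn_nprime m : ~~ prime p -> logn p m = 0%N.
Proof. by rewrite lognE => /negbTE ->. Qed.

Lemma padic_abs0 : abs 0 = 0.
Proof. by rewrite /padic_abs eqxx. Qed.

Lemma padic_abs_frac (a b : int) : a != 0 -> b != 0 ->
  abs (a%:~R / b%:~R) = p%:R ^ ((logn p `|b|%N)%:Z - (logn p `|a|%N)%:Z).
Proof.
move=> a0 b0; rewrite /padic_abs; set q := _ / _.
have q0 : q != 0 by rewrite mulf_neq0// ?invr_eq0 intr_eq0.
rewrite (negbTE q0); congr (_ ^ _).
have E : numq q * b = a * denq q.
  apply: (@intr_inj rat); rewrite !intrM.
  have d0 : (denq q)%:~R != 0 :> rat by rewrite intr_eq0 denq_eq0.
  have b0' : b%:~R != 0 :> rat by rewrite intr_eq0.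
  have : (numq q)%:~R / (denq q)%:~R = a%:~R / b%:~R :> rat.
    by rewrite divq_num_den.
  by move/eqP; rewrite eqr_div// => /eqP.
have := congr1 (fun z : int => logn p `|z|%N) E.
rewrite !abszM !lognM ?absz_gt0 ?numq_eq0 ?denq_eq0//.
by move=> h; lia.
Qed.

Lemma padic_abs_ge0 q : 0 <= abs q.
Proof. by rewrite /padic_abs; case: ifP => // _; apply: exprz_ge0. Qed.

Lemma padic_abs_gt0 q : q != 0 -> 0 < abs q.
Proof.
rewrite /padic_abs => /negbTE ->.
case: (boolP (prime p)) => [pp|np]; last by rewrite !logn_nprime// expr0z.
by apply: exprz_gt0; rewrite ltr0n prime_gt0.
Qed.

Lemma padic_abs_eq0 q : (abs q == 0) = (q == 0).
Proof.
apply/idP/idP => [|/eqP ->]; last by rewrite padic_abs0.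
by apply: contraTT => /padic_abs_gt0; rewrite lt0r => /andP[].
Qed.

Lemma padic_absN q : abs (- q) = abs q.
Proof. by rewrite /padic_abs oppr_eq0 numqN denqN abszN. Qed.

Lemma padic_abs1 : abs 1 = 1.
Proof. by rewrite /padic_abs /= logn1 subrr expr0z. Qed.

Lemma padic_absM x y : abs (x * y) = abs x * abs y.
Proof.
have [->|x0] := eqVneq x 0; first by rewrite mul0r padic_abs0 mul0r.
have [->|y0] := eqVneq y 0; first by rewrite mulr0 padic_abs0 mulr0.
rewrite -(divq_num_den x) -(divq_num_den y) mulf_div -!intrM.
rewrite !padic_abs_frac ?mulf_neq0 ?numq_eq0 ?denq_eq0//.
rewrite !abszM !lognM ?absz_gt0 ?numq_eq0 ?denq_eq0//.
case: (boolP (prime p)) => [pp|np]; last first.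
  by rewrite !logn_nprime// subrr !expr0z mulr1.
rewrite -expfzDr ?pnatr_eq0 -?lt0n ?prime_gt0//; congr (_ ^ _); lia.
Qed.

Lemma padic_absV x : abs x^-1 = (abs x)^-1.
Proof.
have [->|x0] := eqVneq x 0; first by rewrite invr0 padic_abs0 invr0.
have ax0 : abs x != 0 by rewrite padic_abs_eq0.
by apply: (mulfI ax0); rewrite -padic_absM !divff// padic_abs1.
Qed.

Lemma padic_abs_ultra x y : abs (x + y) <= Num.max (abs x) (abs y).
Proof.
have [->|x0] := eqVneq x 0; first by rewrite add0r le_max lexx orbT.
have [->|y0] := eqVneq y 0; first by rewrite addr0 le_max lexx.
have [->|xy0] := eqVneq (x + y) 0.
  by rewrite padic_abs0 le_max padic_abs_ge0.
case: (boolP (prime p)) => [pp|np]; last first.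
  rewrite /padic_abs (negbTE x0) (negbTE y0) (negbTE xy0).
  by rewrite !logn_nprime// subrr !expr0z le_max lexx.
pose d := denq x * denq y; pose a := numq x * denq y; pose b := numq y * denq x.
have dx0 := denq_neq0 x; have dy0 := denq_neq0 y.
have d0 : d != 0 by rewrite mulf_neq0.
have Ex : x = a%:~R / d%:~R.
  by rewrite /a /d !intrM -mulf_div divff ?intr_eq0// mulr1 divq_num_den.
have Ey : y = b%:~R / d%:~R.
  by rewrite /b /d [denq x * _]mulrC !intrM -mulf_div divff ?intr_eq0// mulr1
    divq_num_den.
have a0 : a != 0 by rewrite mulf_neq0 ?numq_eq0.
have b0 : b != 0 by rewrite mulf_neq0 ?numq_eq0.
have Exy : x + y = (a + b)%:~R / d%:~R by rewrite Ex Ey -mulrDl intrD.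
have ab0 : a + b != 0.
  by apply: contraNneq xy0 => h; rewrite Exy h mul0r.
rewrite Exy Ex Ey !padic_abs_frac//.
have p1 : 1 <= p%:R :> R by rewrite ler1n prime_gt0.
have key : (minn (logn p `|a|) (logn p `|b|) <= logn p `|(a + b)%R|)%N.
  rewrite -pfactor_dvdn ?absz_gt0//.
  have ha : (p ^ minn (logn p `|a|) (logn p `|b|) %| `|a|)%N.
    by rewrite pfactor_dvdn ?absz_gt0// geq_minl.
  have hb : (p ^ minn (logn p `|a|) (logn p `|b|) %| `|b|)%N.
    by rewrite pfactor_dvdn ?absz_gt0// geq_minr.
  move: ha hb; set m := (p ^ _)%N => ha hb.
  have : (m%:Z %| a + b)%Z by apply: rpredD; rewrite dvdzE.
  by rewrite dvdzE.
rewrite le_max; apply/orP.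
have [h|h] := leqP (logn p `|a|) (logn p `|b|); [left|right];
  apply: (ler_weXz2l p1); move: key; rewrite /minn; case: ifP; lia.
Qed.

Lemma padic_absD x y : abs (x + y) <= abs x + abs y.
Proof.
apply: (le_trans (padic_abs_ultra x y)).
by rewrite ge_max lerDl lerDr !padic_abs_ge0.
Qed.

Lemma padic_abs_distC x y : abs (x - y) = abs (y - x).
Proof. by rewrite -padic_absN opprB. Qed.

Lemma padic_abs_isosceles x y : abs (x - y) < abs y -> abs x = abs y.
Proof.
move=> h; apply/eqP; rewrite eq_le; apply/andP; split.
  have := padic_abs_ultra (x - y) y; rewrite subrK => /le_trans; apply.
  by rewrite ge_max lexx ltW.
have := padic_abs_ultra (y - x) x; rewrite subrK padic_abs_distC le_max.
by case/orP => //; rewrite leNgt h.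
Qed.
End PadicAbs.

Definition padic_cauchy (R : realType) (p : nat) : {pred (nat -> rat)} :=
  fun u => `[< forall e : R, 0 < e -> exists N : nat,
    forall m n : nat, (N <= m)%N -> (N <= n)%N -> padic_abs R p (u m - u n) < e >].

Section CauchyRing.
Context (R : realType) (p : nat).
Local Notation abs := (@padic_abs R p).

Lemma padic_cauchy_bounded u : u \in padic_cauchy R p ->
  exists2 B : R, 0 < B & exists N, forall n, (N <= n)%N -> abs (u n) <= B.
Proof.
move/asboolP => /(_ 1 ltr01)[N hN]; exists (1 + abs (u N)).
  by rewrite ltr_pwDl// padic_abs_ge0.
exists N => n Nn; rewrite -{1}(subrK (u N) (u n)).
apply: (le_trans (padic_absD _ _ _ _)); rewrite lerD2r ltW//.
exact: hN.
Qed.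

Lemma padic_cauchy_subring : subring_closed (padic_cauchy R p).
Proof.
split=> [|u v /asboolP hu /asboolP hv|u v ru rv].
- apply/asboolP => e e0; exists 0%N => m n _ _.
  by rewrite /GRing.one /= subrr padic_abs0.
- apply/asboolP => e e0.
  have [N hN] := hu _ e0; have [M hM] := hv _ e0.
  exists (maxn N M) => m n; rewrite !geq_max => /andP[Nm Mm] /andP[Nn Mn].
  have -> : (u - v) m - (u - v) n = (u m - u n) + (v n - v m).
    by change ((u m - v m) - (u n - v n) = (u m - u n) + (v n - v m)); ring.
  apply: (le_lt_trans (padic_abs_ultra _ _ _ _)).
  by rewrite gt_max hN// hM.
- have [B B0 [NB hB]] := padic_cauchy_bounded ru.
  have [C C0 [NC hC]] := padic_cauchy_bounded rv.
  apply/asboolP => e e0.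
  move/asboolP: ru => /(_ (e / C))[|N hN]; first by rewrite divr_gt0.
  move/asboolP: rv => /(_ (e / B))[|M hM]; first by rewrite divr_gt0.
  exists (maxn (maxn N M) (maxn NB NC)) => m n.
  rewrite !geq_max => /andP[/andP[Nm Mm] /andP[Bm Cm]].
  move=> /andP[/andP[Nn Mn] /andP[Bn Cn]].
  have -> : (u * v) m - (u * v) n = (u m - u n) * v m + u n * (v m - v n).
    by change (u m * v m - u n * v n = (u m - u n) * v m + u n * (v m - v n)); ring.
  apply: (le_lt_trans (padic_abs_ultra _ _ _ _)).
  rewrite !padic_absM gt_max; apply/andP; split.
    apply: (@le_lt_trans _ _ (abs (u m - u n) * C)).
      by rewrite ler_wpM2l ?padic_abs_ge0 ?hC.
    by rewrite -ltr_pdivlMr// hN.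
  apply: (@le_lt_trans _ _ (B * abs (v m - v n))).
    by rewrite ler_wpM2r ?padic_abs_ge0 ?hB.
  by rewrite mulrC -ltr_pdivlMr// hM.
Qed.

HB.instance Definition _ :=
  GRing.isSubringClosed.Build (nat -> rat) (padic_cauchy R p)
    padic_cauchy_subring.
End CauchyRing.

Record padic_cseq (R : realType) (p : nat) := PadicCSeq {
  padic_seq :> nat -> rat;
  padic_seqP : padic_seq \in padic_cauchy R p }.

HB.instance Definition _ (R : realType) (p : nat) :=
  [isSub for @padic_seq R p].
HB.instance Definition _ (R : realType) (p : nat) :=
  [Choice of padic_cseq R p by <:].
HB.instance Definition _ (R : realType) (p : nat) :=
  [SubChoice_isSubComNzRing of padic_cseq R p by <:].

Definition padic_null (R : realType) (p : nat) : {pred padic_cseq R p} :=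
  fun u => `[< forall e : R, 0 < e -> exists N : nat,
    forall n : nat, (N <= n)%N -> padic_abs R p (u n) < e >].

Section NullIdeal.
Context (R : realType) (p : nat).
Local Notation abs := (@padic_abs R p).

Lemma padic_cseqN (u : padic_cseq R p) n : (- u) n = - u n.
Proof. by []. Qed.
Lemma padic_cseqD (u v : padic_cseq R p) n : (u + v) n = u n + v n.
Proof. by []. Qed.
Lemma padic_cseqM (u v : padic_cseq R p) n : (u * v) n = u n * v n.
Proof. by []. Qed.
Lemma padic_cseq1 n : (1 : padic_cseq R p) n = 1.
Proof. by []. Qed.
Lemma padic_cseq0 n : (0 : padic_cseq R p) n = 0.
Proof. by []. Qed.

Lemma padic_null_ideal : idealr_closed (@padic_null R p).
Proof.
split=> [||a u v /asboolP hu /asboolP hv].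
- apply/asboolP => e e0; exists 0%N => n _.
  by rewrite padic_cseq0 padic_abs0.
- apply/asboolPn => /(_ 1 ltr01)[N /(_ N (leqnn N))].
  by rewrite padic_cseq1 padic_abs1 ltxx.
- have [B B0 [N hB]] := padic_cauchy_bounded (padic_seqP a).
  apply/asboolP => e e0.
  have [M hM] := hu (e / B) (divr_gt0 e0 B0); have [K hK] := hv _ e0.
  exists (maxn N (maxn M K)) => n; rewrite !geq_max => /and3P[Nn Mn Kn].
  rewrite padic_cseqD padic_cseqM.
  apply: (le_lt_trans (padic_abs_ultra _ _ _ _)); rewrite gt_max hK// andbT.
  rewrite padic_absM (@le_lt_trans _ _ (B * abs (u n)))//.
    by rewrite ler_wpM2r ?padic_abs_ge0 ?hB.
  by rewrite mulrC -ltr_pdivlMr// hM.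
Qed.

HB.instance Definition _ :=
  isIdealr.Build (padic_cseq R p) (@padic_null R p) padic_null_ideal.

Lemma padic_nonnull_stationary (u : padic_cseq R p) : u \notin @padic_null R p ->
  exists2 c : R, 0 < c & exists N, forall n, (N <= n)%N -> abs (u n) = c.
Proof.
move=> /asboolPn /existsNP[e /not_implyP[e0 /forallNP he]].
have /asboolP/(_ e e0)[N hN] := padic_seqP u.
have /existsNP[k /not_implyP[Nk /negP]] := he N; rewrite -leNgt => ek.
exists (abs (u k)); first exact: lt_le_trans ek.
exists N => n Nn; apply: padic_abs_isosceles.
by apply: lt_le_trans ek; exact: hN.
Qed.

Lemma padic_nonnull_inv (u : padic_cseq R p) : u \notin @padic_null R p ->
  exists v : padic_cseq R p, v * u - 1 \in @padic_null R p.
Proof.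
move=> /[dup] un0 /padic_nonnull_stationary [c c0 [N hN]].
have vP : (fun n => (u n)^-1) \in padic_cauchy R p.
  apply/asboolP => e e0.
  have /asboolP/(_ (e * (c * c)))[|M hM] := padic_seqP u.
    by rewrite !mulr_gt0.
  exists (maxn N M) => m n; rewrite !geq_max => /andP[Nm Mm] /andP[Nn Mn].
  have um0 : u m != 0 by rewrite -(padic_abs_eq0 R p) hN ?gt_eqF.
  have un0' : u n != 0 by rewrite -(padic_abs_eq0 R p) hN ?gt_eqF.
  have -> : (u m)^-1 - (u n)^-1 = (u n - u m) * ((u m)^-1 * (u n)^-1).
    by field; rewrite um0 un0'.
  rewrite !padic_absM !padic_absV !hN// -invfM ltr_pdivrMr ?mulr_gt0//.
  exact: hM.
exists (PadicCSeq vP); apply/asboolP => e e0; exists N => n Nn.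
rewrite padic_cseqD padic_cseqN padic_cseqM padic_cseq1 /= mulVf.
  by rewrite subrr padic_abs0.
by rewrite -(padic_abs_eq0 R p) hN ?gt_eqF.
Qed.
End NullIdeal.

Definition Qp (R : realType) (p : nat) : Type := {ideal_quot @padic_null R p}.

HB.instance Definition _ (R : realType) (p : nat) :=
  GRing.ComNzRing.on (Qp R p).
HB.instance Definition _ (R : realType) (p : nat) :=
  Quotient.on (Qp R p).

Section QpField.
Context (R : realType) (p : nat).
Local Notation abs := (@padic_abs R p).

Lemma Qp_pi0 (u : padic_cseq R p) :
  (\pi_(Qp R p) u == 0) = (u \in @padic_null R p).
Proof.
have := Quotient.idealrBE (@padic_null R p) u 0; rewrite subr0 => ->.
by rewrite -[0 in LHS](rmorph0 \pi_(Qp R p)).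
Qed.

Lemma Qp_piP (x : Qp R p) : exists u : padic_cseq R p, x = \pi u.
Proof. by exists (repr x); rewrite reprK. Qed.

Definition Qp_inv (x : Qp R p) : Qp R p := xget 0 [set y | y * x = 1].

Lemma Qp_mulVf x : x != 0 -> Qp_inv x * x = 1.
Proof.
have [u ->] := Qp_piP x; rewrite Qp_pi0 => /padic_nonnull_inv[v vu].
apply: (@xgetPex _ 0 [set y | y * \pi_(Qp R p) u = 1]); exists (\pi v) => /=.
apply/eqP; rewrite -subr_eq0 -(rmorph1 \pi_(Qp R p)).
by rewrite -rmorphM -rmorphB Qp_pi0.
Qed.

Lemma Qp_inv0 : Qp_inv 0 = 0.
Proof.
by apply: xgetPN => y /= /eqP; rewrite mulr0 eq_sym oner_eq0.
Qed.

HB.instance Definition _ :=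
  GRing.ComNzRing_isField.Build (Qp R p) Qp_mulVf Qp_inv0.

Definition Qp_abs (x : Qp R p) : R :=
  limn (fun n => padic_abs R p (repr x n)).

Lemma Qp_abs_cvg (u : padic_cseq R p) :
  (fun n => abs (u n)) @ \oo --> Qp_abs (\pi u).
Proof.
have cvgu (v : padic_cseq R p) : cvgn (fun n => abs (v n)).
  have [/asboolP v0|/padic_nonnull_stationary[c c0 [N hN]]] :=
    boolP (v \in @padic_null R p).
    apply/cvg_ex; exists 0; apply/cvgrPdist_lt => e /v0[N hN].
    exists N => // n /= /hN.
    by rewrite sub0r normrN ger0_norm// padic_abs_ge0.
  apply/cvg_ex; exists c; apply/cvgrPdist_lt => e e0.
  by exists N => // n /= /hN ->; rewrite subrr normr0.
set v := repr (\pi_(Qp R p) u).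
have /asboolP uv : u - v \in @padic_null R p.
  by rewrite -Qp_pi0 rmorphB /= reprK subrr.
have -> : (fun n => abs (u n)) =
    (fun n => abs (v n)) \+ (fun n => abs (u n) - abs (v n)).
  by apply/funext => n /=; rewrite addrC subrK.
rewrite -[Qp_abs _]addr0; apply: cvgD; first exact: cvgu.
apply/cvgrPdist_lt => e /uv[N hN]; exists N => // n /= /hN.
rewrite sub0r normrN; apply: le_lt_trans.
rewrite padic_cseqD padic_cseqN ler_norml; apply/andP; split.
  rewrite lerNl opprB lerBlDr padic_abs_distC.
  by have := padic_absD R p (v n - u n) (u n); rewrite subrK.
by rewrite lerBlDr; have := padic_absD R p (u n - v n) (v n); rewrite subrK.
Qed.

Arguments Qp_abs_cvg : clear implicits.

Lemma Qp_abs_ge0 x : 0 <= Qp_abs x.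
Proof.
have [u ->] := Qp_piP x; apply: (ler_cvg_to (cvg_cst 0) (Qp_abs_cvg u)).
by apply: nearW => n; exact: padic_abs_ge0.
Qed.

Lemma Qp_abs_pi_eq (u : padic_cseq R p) (c : R) N :
  (forall n, (N <= n)%N -> abs (u n) = c) -> Qp_abs (\pi u) = c.
Proof.
move=> h; apply: (cvg_unique _ (Qp_abs_cvg u)) => //.
by apply: cvg_near_cst; exists N => // n /= /h.
Qed.

Lemma Qp_abs0 : Qp_abs 0 = 0.
Proof.
rewrite -(rmorph0 \pi_(Qp R p)); apply: (@Qp_abs_pi_eq _ _ 0%N) => n _.
by rewrite padic_cseq0 padic_abs0.
Qed.

Lemma Qp_abs_eq0 x : (Qp_abs x == 0) = (x == 0).
Proof.
apply/idP/idP => [|/eqP ->]; last by rewrite Qp_abs0.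
have [u ->] := Qp_piP x; apply: contraTT; rewrite Qp_pi0.
move=> /padic_nonnull_stationary[c c0 [N hN]].
by rewrite (Qp_abs_pi_eq hN) gt_eqF.
Qed.

Lemma Qp_absN x : Qp_abs (- x) = Qp_abs x.
Proof.
have [u ->] := Qp_piP x; rewrite -rmorphN.
apply: (cvg_unique _ (Qp_abs_cvg (- u))) => //.
rewrite (_ : (fun n => _) = (fun n => abs (u n))); first exact: Qp_abs_cvg.
by apply/funext => n; rewrite padic_cseqN padic_absN.
Qed.

Lemma Qp_absM x y : Qp_abs (x * y) = Qp_abs x * Qp_abs y.
Proof.
have [u ->] := Qp_piP x; have [v ->] := Qp_piP y; rewrite -rmorphM.
apply: (cvg_unique _ (Qp_abs_cvg (u * v))) => //.
rewrite (_ : (fun n => _) = (fun n => abs (u n)) \* (fun n => abs (v n))).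
  by apply: cvgM; exact: Qp_abs_cvg.
by apply/funext => n; rewrite padic_cseqM padic_absM.
Qed.

Lemma Qp_abs_ultra x y : Qp_abs (x + y) <= Num.max (Qp_abs x) (Qp_abs y).
Proof.
have [u ->] := Qp_piP x; have [v ->] := Qp_piP y; rewrite -rmorphD.
have h : (fun n => Num.max (abs (u n)) (abs (v n))) @ \oo -->
    Num.max (Qp_abs (\pi u)) (Qp_abs (\pi v)).
  rewrite maxr_absE; under eq_fun do rewrite maxr_absE.
  apply: cvgM; last exact: cvg_cst.
  apply: cvgD; first by apply: cvgD; exact: Qp_abs_cvg.
  by apply: cvg_norm; apply: cvgB; exact: Qp_abs_cvg.
apply: (ler_cvg_to (Qp_abs_cvg (u + v)) h).
by apply: nearW => n; exact: padic_abs_ultra.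
Qed.

Lemma Qp_absD x y : Qp_abs (x + y) <= Qp_abs x + Qp_abs y.
Proof.
apply: (le_trans (Qp_abs_ultra x y)).
by rewrite ge_max lerDl lerDr !Qp_abs_ge0.
Qed.

End QpField.

Arguments Qp_abs_cvg {R p} u.

Section QpMetric.
Context (R : realType) (p : nat).

Let dist (x y : Qp R p) : R := Qp_abs (x - y).

Let distxx x : dist x x = 0.
Proof. by rewrite /dist subrr Qp_abs0. Qed.

Let dist_eq0 x y : dist x y = 0 -> x = y.
Proof. by move=> /eqP; rewrite Qp_abs_eq0 subr_eq0 => /eqP. Qed.

Let dist_sym x y : dist x y = dist y x.
Proof. by rewrite /dist -Qp_absN opprB. Qed.

Let dist_triangle y x z : dist x z <= dist x y + dist y z.
Proof. by rewrite /dist -(subrKA y); exact: Qp_absD. Qed.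

HB.instance Definition _ := isMetric.Build R (Qp R p)
  distxx dist_eq0 dist_sym dist_triangle.

Lemma Qp_mdistE (x y : Qp R p) : mdist x y = Qp_abs (x - y).
Proof. by []. Qed.

End QpMetric.

Section QpRat.
Context (R : realType) (p : nat).
Local Notation abs := (@padic_abs R p).

Lemma padic_cauchy_cst (q : rat) : (fun=> q) \in padic_cauchy R p.
Proof.
apply/asboolP => e e0; exists 0%N => m n _ _.
by rewrite subrr padic_abs0.
Qed.

Lemma Qp_ratrE (q : rat) :
  ratr q = \pi_(Qp R p) (PadicCSeq (padic_cauchy_cst q)).
Proof.
have E (z : int) : \pi_(Qp R p) (PadicCSeq (padic_cauchy_cst z%:~R)) = z%:~R.
  rewrite -(rmorph_int \pi_(Qp R p)); congr (\pi_(Qp R p) _).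
  apply: val_inj; apply/funext => n /=.
  have h k : (k%:R : padic_cseq R p) n = k%:R.
    by elim: k => // k IH; rewrite -!natr1 padic_cseqD IH.
  by case: z => k; rewrite ?NegzE ?mulrNz ?padic_cseqN -!pmulrn h.
rewrite /ratr -!E.
have d0 : \pi_(Qp R p) (PadicCSeq (padic_cauchy_cst (denq q)%:~R)) != 0.
  rewrite Qp_pi0; apply/asboolPn.
  have d0 : 0 < abs (denq q)%:~R by rewrite padic_abs_gt0// intr_eq0 denq_eq0.
  by move=> /(_ _ d0)[N /(_ N (leqnn N))] /=; rewrite ltxx.
apply: (mulIf d0); rewrite divfK// -rmorphM; congr (\pi_(Qp R p) _).
apply: val_inj; apply/funext => n.
change ((numq q)%:~R = q * (denq q)%:~R).
by rewrite -{2}(divq_num_den q) divfK// intr_eq0 denq_eq0.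
Qed.

Lemma Qp_ratrB (q r : rat) : ratr (q - r) = ratr q - ratr r :> Qp R p.
Proof.
by rewrite !Qp_ratrE -rmorphB; congr (\pi_(Qp R p) _); exact: val_inj.
Qed.

Lemma Qp_abs_ratr (q : rat) : Qp_abs (ratr q : Qp R p) = abs q.
Proof. by rewrite Qp_ratrE; apply: (@Qp_abs_pi_eq _ _ _ _ 0%N). Qed.

Lemma Qp_rat_dense (x : Qp R p) (e : R) : 0 < e ->
  exists q : rat, Qp_abs (x - ratr q) < e.
Proof.
have [u ->] := Qp_piP x => e0.
have /asboolP/(_ (e / 2))[|N hN] := padic_seqP u; first by rewrite divr_gt0.
exists (u N); rewrite Qp_ratrE -rmorphB.
apply: (@le_lt_trans _ _ (e / 2)); last by rewrite ltr_pdivrMr// ltr_pMr// ltr1n.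
apply: (ler_cvg_to (Qp_abs_cvg _) (cvg_cst _)).
by exists N => // n /= Nn; exact: ltW (hN _ _ _ _).
Qed.

Lemma Qp_complete (x : nat -> Qp R p) :
  (forall e : R, 0 < e -> exists N : nat, forall m n : nat,
    (N <= m)%N -> (N <= n)%N -> Qp_abs (x m - x n) < e) ->
  exists l : Qp R p, forall e : R, 0 < e -> exists N : nat, forall n : nat,
    (N <= n)%N -> Qp_abs (x n - l) < e.
Proof.
move=> hx.
have /choice[q hq] n : exists q, Qp_abs (x n - ratr q) < n.+1%:R^-1.
  by apply: Qp_rat_dense; rewrite invr_gt0.
have small (e : R) : 0 < e ->
    exists N, forall n, (N <= n)%N -> Qp_abs (x n - ratr (q n)) < e.
  move=> e0; exists (Num.bound e^-1) => n Nn; apply: (lt_le_trans (hq n)).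
  rewrite invf_ple ?posrE//; apply/ltW.
  apply: (lt_le_trans (archi_boundP _)); first by rewrite invr_ge0 ltW.
  by rewrite ler_nat leqW.
have qP : q \in padic_cauchy R p.
  apply/asboolP => e e0; have [N hN] := small _ e0; have [M hM] := hx _ e0.
  exists (maxn N M) => m n; rewrite !geq_max => /andP[Nm Mm] /andP[Nn Mn].
  rewrite -Qp_abs_ratr Qp_ratrB.
  have -> : ratr (q m) - ratr (q n) = - (x m - ratr (q m)) +
      ((x m - x n) + (x n - ratr (q n))) :> Qp R p by ring.
  apply: (le_lt_trans (Qp_abs_ultra _ _)); rewrite gt_max Qp_absN hN//=.
  by apply: (le_lt_trans (Qp_abs_ultra _ _)); rewrite gt_max hM//= hN.
exists (\pi_(Qp R p) (PadicCSeq qP)) => e e0; have [N hN] := small _ e0.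
move/asboolP: (qP) => /(_ (e / 2))[|M hM]; first by rewrite divr_gt0.
exists (maxn N M) => n; rewrite !geq_max => /andP[Nn Mn].
rewrite -(subrKA (ratr (q n))); apply: (le_lt_trans (Qp_abs_ultra _ _)).
rewrite gt_max hN//= Qp_ratrE -rmorphB.
apply: (@le_lt_trans _ _ (e / 2)); last by rewrite ltr_pdivrMr// ltr_pMr// ltr1n.
apply: (ler_cvg_to (Qp_abs_cvg _) (cvg_cst _)).
by exists M => // k /= Mk; exact: ltW (hM _ _ _ _).
Qed.

End QpRat.

Section Hausdorff.
Context (R : realType) (T : metricType R).
Local Open Scope ereal_scope.

Definition diameter (U : set T) : \bar R :=
  ereal_sup [set d | d = 0 \/ exists x y, [/\ U x, U y & d = (mdist x y)%:E]].

(* The empty set has weight 0 also when s = 0, where 0 `^ 0 = 1. *)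
Definition diameter_pow (s : R) (U : set T) : \bar R :=
  if U == set0 then 0 else diameter U `^ s.

Definition delta_cover (delta : R) (A : set T) : set (set T)^nat :=
  [set U | (forall k, diameter (U k) <= delta%:E) /\
           A `<=` \bigcup_k U k].

Definition hausdorff_premeasure (s delta : R) (A : set T) : \bar R :=
  ereal_inf [set \sum_(0 <= k <oo) diameter_pow s (U k)
            | U in delta_cover delta A].

Definition hausdorff_measure (s : R) (A : set T) : \bar R :=
  ereal_sup [set hausdorff_premeasure s delta A
            | delta in [set delta : R | (0 < delta)%R]].

Definition hausdorff_dim (A : set T) : \bar R :=
  ereal_inf [set s%:E | s in [set s : R | (0 <= s)%R /\
                                          hausdorff_measure s A = 0]].
End Hausdorff.

(* The maxima are of nonnegative quantities, so their default value 0 is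
   harmless. *)
Definition approximable (R : realType) (p n : nat) (xi : Qp R p)
    (lambda X : R) : Prop :=
  exists x : 'I_n.+1 -> int,
    \big[Num.max/0]_(i < n.+1) `|(x i)%:~R : R| <= X /\
    0 < \big[Num.max/0]_(m < n.+1 | (1 <= m)%N)
          Qp_abs ((x ord0)%:~R * xi ^+ m - (x m)%:~R)
      <= X `^ (- lambda - 1).

Definition padic_lambda (R : realType) (p n : nat) (xi : Qp R p) : \bar R :=
  ereal_sup [set lambda%:E | lambda in
    [set lambda : R | forall B : R,
      exists2 X : R, B <= X & approximable n xi lambda X]].

(* Main.v *)
Require Import Defs.
From mathcomp Require Import all_boot all_order all_algebra.
From mathcomp Require Import zify ring lra.
From mathcomp Require Import all_classical all_reals all_analysis.

Import Order.TTheory GRing.Theory Num.Theory.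
Local Open Scope classical_set_scope.
Local Open Scope ring_scope.

(** Put [H] for the height of an integer quadratic [P], and let [alpha] be a
p-adic integer root of [P] at which [P'] is a unit.  Integer vectors
[(x_0, ..., x_n)] obeying the three-term recurrence with the coefficients of
[P] are cut out by [n - 1] equations with coefficients at most [H]; asking in
addition that [x_n] be congruent to [alpha * x_(n-1)] modulo [p ^ (4u)], the
pigeonhole principle produces a nonzero one with entries at most
[X = p ^ (3u)] as soon as [p ^ (2u)] is at least [(7H) ^ (n-1)]
([recurrence_pigeonhole]).  Run backwards, the recurrence makes the vector
geometric, [x_m = x_0 * alpha ^ m] modulo [p ^ (4u)] ([recurrence_geometric]).
As [p ^ (- 4u) = X ^ (- 1/3 - 1)], every irrational [xi] within [p ^ (- 4u)] of
[alpha] has an approximation of quality [1/3] at scale [X]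
([approximable_of_integer_approx]).  Points that admit such quadratics of
unbounded height therefore satisfy [lambda_n >= 1/3].

There are about [H ^ 3] quadratics of height [H], and the balls just described
have radius about [H ^ (- 2(n-1))]; if their centres are spread evenly at scale
[H ^ (-3)], a Cantor set of such points has dimension [3 / (2(n-1))], which is
the asserted bound.  Since it is enough to refute
[hausdorff_measure t = 0] for each [t] below that value, factors [H ^ epsilon]
may be lost everywhere.

The even spreading is the arithmetic core ([exists_children]).  Fix
[q = p ^ (3N)], about [H ^ 3], and a unit residue [xi] modulo [q].  Unless some
nonzero [(x_0, x_1, x_2)] shorter than [q / H ^ (1+epsilon)] is proportional to
[(1, xi, xi ^ 2)] modulo [q], every residue is a value at [xi] of a quadratic of
height about [H ^ (1+epsilon)] ([quad_transference]); applied to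
[- (xi %/ p)], this gives a quadratic that vanishes at [xi] modulo [q], has
derivative [1] modulo [p], and whose root is found by Hensel's lemma
([approx_of_no_short_dual]).  The exceptional [xi] are rare
([count_short_dual]): [x_0 * x_2 - x_1 ^ 2] is a small multiple of [q], so [x_1]
and that multiple leave for [x_0] only the divisors of a fixed nonzero integer,
and these are few ([divisor_bound]).

The Cantor set is handled without constructing a measure.  The points of level
[K] in a residue class are counted directly ([class_count_mass]), and a
compactness argument on the tree of residues ([light_classes_avoidable]) shows
that countably many classes of small total weight miss a point of the set.  A
cover with small Hausdorff sum yields such classes, and the countably many
rational points, where approximations could degenerate to equalities, are added
to them at negligible cost ([hausdorff_measure_neq0]). *)

Set Implicit Arguments.
Unset Strict Implicit.

(** * Divisors *)

Section DivisorBound.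
Local Open Scope nat_scope.

Lemma size_divisors n : size (divisors n) = \prod_(f <- prime_decomp n) f.2.+1.
Proof.
rewrite /divisors; elim: (prime_decomp n) => [|[q e] s IHs] /=; first by rewrite big_nil.
rewrite big_cons /= -IHs; elim: e => [|e IHe] /=; first by rewrite mul1n.
by rewrite size_merge size_cat size_map IHe mulSn addnC.
Qed.

(** As [e.+1] is at most [k * (e %/ k).+1], this reduces to [i < 2 ^ i]. *)
Lemma expn_bounded_by_exp2 k e : 0 < k -> e.+1 ^ k <= k ^ k * 2 ^ e.
Proof.
move=> k0; apply: (@leq_trans ((k * 2 ^ (e %/ k)) ^ k)).
  rewrite leq_exp2r//; apply: leq_trans (leq_mul (leqnn k) (ltn_expl _ (leqnn 2))).
  by rewrite mulnC ltn_ceil.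
by rewrite expnMn leq_mul// -expnM leq_exp2l// leq_trunc_div.
Qed.

(** The number of divisors is a product over prime powers [l ^ e] of [n].  Once
[l >= 2 ^ k], the factor [e.+1 ^ k <= (2 ^ e) ^ k] is already at most [l ^ e];
each of the fewer than [2 ^ k] smaller primes costs one constant [k ^ k]. *)
Lemma divisor_bound k : 0 < k ->
  exists C, forall n, 0 < n -> size (divisors n) ^ k <= C * n.
Proof.
move=> k0; pose c q := if q < 2 ^ k then k ^ k else 1.
have kk0 : 0 < k ^ k by rewrite expn_gt0 k0.
exists ((k ^ k) ^ 2 ^ k) => n n0.
have -> : size (divisors n) ^ k = \prod_(f <- prime_decomp n) f.2.+1 ^ k.
  rewrite size_divisors; elim/big_rec2: _ => [|f a b _ <-]; first by rewrite exp1n.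
  by rewrite expnMn.
apply: (@leq_trans (\prod_(f <- prime_decomp n) (c f.1 * f.1 ^ f.2))).
  rewrite !big_seq; apply: leq_prod => -[q e] /mem_prime_decomp[pq e0 _] /=.
  rewrite /c; case: ltnP => hq.
    apply: leq_trans (expn_bounded_by_exp2 _ k0) _.
    by rewrite leq_mul// leq_exp2r// prime_gt1.
  rewrite mul1n; apply: (@leq_trans ((2 ^ e) ^ k)).
    by rewrite leq_exp2r// ltn_expl.
  by rewrite -expnM mulnC expnM leq_exp2r.
rewrite big_split /= -prod_prime_decomp// leq_mul//.
rewrite -(big_map fst xpredT c) -/(unzip1 _) -/(primes n).
rewrite (bigID (fun q => q < 2 ^ k)) /= [X in _ * X]big1 ?muln1; last first.
  by move=> q; rewrite /c => /negbTE ->.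
rewrite (eq_bigr (fun=> k ^ k)); last by move=> q; rewrite /c => ->.
rewrite -big_filter big_const_seq count_predT iter_muln_1 leq_pexp2l//.
rewrite -{2}(size_iota 0 (2 ^ k)); apply: uniq_leq_size.
  by rewrite filter_uniq// primes_uniq.
by move=> q; rewrite mem_filter mem_iota => /andP[].
Qed.
End DivisorBound.

(** * Residues with a short dual vector *)

Section ShortDualVectors.
Variable p : nat.
Hypothesis p_prime : prime p.

(** The vectors congruent to multiples of [(1, xi, xi ^ 2)] form, up to scaling by
[q], the dual of the lattice of quadratics vanishing at [xi] modulo [q]. *)
Definition short_dual (q xi Y : nat) : Prop := exists x0 x1 x2 : int,
  [/\ (x0, x1, x2) != (0, 0, 0),
      [/\ (`|x0| <= Y)%N, (`|x1| <= Y)%N & (`|x2| <= Y)%N],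
      (q%:Z %| x0 * xi%:Z - x1)%Z & (q%:Z %| x0 * xi%:Z ^+ 2 - x2)%Z].

Lemma dvdz_small (q : nat) (x : int) : (q%:Z %| x)%Z -> (`|x| < q)%N -> x = 0.
Proof.
rewrite dvdzE /= => qx xq; apply/eqP; rewrite -absz_eq0; case: posnP => // x0.
by have := dvdn_leq x0 qx; rewrite leqNgt xq.
Qed.

(** As [xi] is a unit and [Y] is below the modulus, a vanishing coordinate would
force the others to vanish; the sign of the first one can be normalised. *)
Lemma short_dual_pos h xi Y : (Y < p ^ h)%N -> ~~ (p %| xi)%N ->
  short_dual (p ^ h) xi Y ->
  exists (x0 : nat) (x1 x2 : int), [/\ (0 < x0)%N,
    [/\ (x0 <= Y)%N, (0 < `|x1| <= Y)%N & (0 < `|x2| <= Y)%N],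
    ((p ^ h)%:Z %| x0%:Z * xi%:Z - x1)%Z &
    ((p ^ h)%:Z %| x0%:Z * xi%:Z ^+ 2 - x2)%Z].
Proof.
move=> Yq pxi [x0 [x1 [x2 [xn0 [hx0 hx1 hx2] d1 d2]]]].
have x00 : x0 != 0.
  apply: contra_neq xn0 => x00; move: d1 d2; rewrite x00 !mul0r !sub0r !dvdzE !abszN.
  move=> d1 d2; congr (_, _, _); apply: (@dvdz_small (p ^ h)) => //.
  - exact: leq_ltn_trans Yq.
  - exact: leq_ltn_trans Yq.
have cop k : coprimez (p ^ h)%:Z (xi%:Z ^+ k).
  by rewrite coprimezE abszX coprimeXl// coprimeXr// prime_coprime.
have nz k (y : int) : ((p ^ h)%:Z %| x0 * xi%:Z ^+ k - y)%Z -> (0 < `|y|)%N.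
  move=> d; rewrite absz_gt0; apply: contraNneq x00 => y0.
  move: d; rewrite y0 subr0 Gauss_dvdzl ?cop// => d; apply/eqP.
  by apply: (dvdz_small d); exact: leq_ltn_trans Yq.
have y1 := nz 1%N _ d1; have y2 := nz 2%N _ d2.
have [x0p|x0n] := leP 0 x0.
  exists `|x0|%N, x1, x2; rewrite absz_gt0 x00 hx0 y1 y2 hx1 hx2.
  by rewrite gez0_abs//; split.
exists `|x0|%N, (- x1), (- x2); rewrite absz_gt0 x00 hx0 !abszN y1 y2 hx1 hx2.
rewrite ltz0_abs// !mulNr -!opprD !dvdzE !abszN -!dvdzE; split=> //.
Qed.

Section Count.
Variables (h Y D : nat).
Let q := (p ^ h)%N.
Let R := (2 * Y ^ 2 %/ q)%N.
Hypothesis Y_lt : (Y < q)%N.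
Hypothesis divisors_le : forall n, (0 < n <= Y ^ 2)%N -> (size (divisors n) <= D)%N.

(** [w] stores both the absolute value of the second coordinate, a multiple of
   [p ^ i], and the top [i] digits of the residue, which are not determined by
   the dual vector. *)
Let middle (i w : nat) : nat := (w - w %% p ^ i)%N.
Let product (j : nat * nat * bool * nat) : nat :=
  let: (i, w, b, t) := j in
  absz ((middle i w)%:Z ^+ 2 + q%:Z * (t%:Z - R%:Z))%R.
Let encodes (xi : nat) (c : nat * nat * bool * nat * nat) : Prop :=
  let: (j, x0) := c in let: (i, w, b, t) := j in
  [/\ [/\ (i < h)%N, (w < (2 * Y).+1)%N & (t < (2 * R).+1)%N],
      (0 < product j <= Y ^ 2)%N /\ (x0 %| product j)%N,
      [/\ (0 < x0)%N, i = logn p x0 & (w %% p ^ i = xi %/ p ^ (h - i))%N] &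
      (q%:Z %| x0%:Z * xi%:Z - (-1) ^+ b * (middle i w)%:Z)%Z].

(** The quantity [x0 * x2 - x1 ^ 2] is divisible by [q] because
[x0 * x2] and [x1 ^ 2] are both congruent to [(x0 * xi) ^ 2]; its quotient by
[q] has size at most [R]. *)
Lemma short_dual_encodes xi : (xi < q)%N -> ~~ (p %| xi)%N ->
  short_dual q xi Y -> exists c, encodes xi c.
Proof.
move=> xiq pxi /(short_dual_pos Y_lt pxi).
move=> [x0 [x1 [x2 [x00 [hx0 /andP[hx1 hx1Y] /andP[hx2 hx2Y]] d1 d2]]]].
pose i := logn p x0; pose r := (xi %/ p ^ (h - i))%N.
have p0 k : (0 < p ^ k)%N by rewrite expn_gt0 prime_gt0.
have ix0 : (p ^ i <= x0)%N by rewrite dvdn_leq// pfactor_dvdnn.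
have ih : (i < h)%N.
  by rewrite -(@ltn_exp2l p) ?prime_gt1// (leq_ltn_trans ix0)// (leq_ltn_trans hx0).
have rlt : (r < p ^ i)%N.
  by rewrite ltn_divLR// -expnD subnKC// ltnW.
have ix1 : (p ^ i %| `|x1|)%N.
  have : ((p ^ i)%:Z %| x0%:Z * xi%:Z)%Z.
    by rewrite dvdz_mulr// dvdzE /= pfactor_dvdnn.
  have : ((p ^ i)%:Z %| x0%:Z * xi%:Z - x1)%Z.
    by apply: dvdz_trans d1; rewrite dvdzE /= dvdn_exp2l// ltnW.
  move=> a b; have : ((p ^ i)%:Z %| x1)%Z.
    have -> : x1 = x0%:Z * xi%:Z - (x0%:Z * xi%:Z - x1) by ring.
    exact: rpredB.
  by rewrite dvdzE.
pose w := (`|x1| + r)%N.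
have wr : (w %% p ^ i = r)%N.
  by rewrite /w -modnDml (eqP ix1) add0n modn_small.
have mid : middle i w = `|x1|%N by rewrite /middle wr addnK.
have dt : (q%:Z %| x0%:Z * x2 - x1 ^+ 2)%Z.
  have -> : x0%:Z * x2 - x1 ^+ 2 =
    (x0%:Z * xi%:Z - x1) * (x0%:Z * xi%:Z + x1) - x0%:Z * (x0%:Z * xi%:Z ^+ 2 - x2).
    by ring.
  by apply: rpredB; [exact: dvdz_mulr|exact: dvdz_mull].
move/dvdzP: dt => [t ht].
have tR : (`|t| <= R)%N.
  have q0 : (0 < q)%N by exact: p0.
  rewrite /R leq_divRL// -[X in (_ * X)%N]/(absz q%:Z) -abszM -ht.
  apply: (@leq_trans (x0 * `|x2| + `|x1| ^ 2)%N).
    rewrite -abszX -[X in (X * _ + _)%N]/(absz x0%:Z) -abszM.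
    by have := IntDist.leqD_dist (x0%:Z * x2) 0 (x1 ^+ 2); rewrite subr0 sub0r abszN.
  rewrite mul2n -addnn leq_add//; first by rewrite -mulnn leq_mul.
  by rewrite leq_exp2r.
have pE : product (i, w, x1 < 0, absz (t + R%:Z)) = (x0 * `|x2|)%N.
  have tR' : (absz (t + R%:Z))%:Z - R%:Z = t.
    by rewrite gez0_abs ?addrK//; clear -tR; lia.
  have x1sq : `|x1|%N%:Z ^+ 2 = x1 ^+ 2 by rewrite abszE real_normK ?num_real.
  rewrite /product mid tR' x1sq.
  by rewrite mulrC -ht addrC subrK abszM.
exists (i, w, x1 < 0, absz (t + R%:Z), x0); rewrite /encodes pE; split.
- split=> //; last by clear -tR; lia.
  by rewrite /w; have := leq_ltn_trans (leq_trans ix0 hx0) Y_lt; clear -rlt ix0 hx0 hx1Y; lia.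
- split; last exact: dvdn_mulr.
  by rewrite muln_gt0 x00 hx2 -mulnn leq_mul.
- by split.
- by rewrite mid -intEsign.
Qed.

(** The congruence [x0 * xi = x1] determines [xi] modulo [p ^ (h - i)], where [i] is
the valuation of [x0]; the code contains the remaining top digits. *)
Lemma encodes_inj xi xi' c : (xi < q)%N -> (xi' < q)%N ->
  encodes xi c -> encodes xi' c -> xi = xi'.
Proof.
case: c => [[[[i w] b] t] x0] xiq xiq' [[ih _ _] _ [x00 iE w1] d] [_ _ [_ _ w2] d'].
have : (q%:Z %| x0%:Z * (xi%:Z - xi'%:Z))%Z.
  have -> : x0%:Z * (xi%:Z - xi'%:Z) = (x0%:Z * xi%:Z - (-1) ^+ b * (middle i w)%:Z)
    - (x0%:Z * xi'%:Z - (-1) ^+ b * (middle i w)%:Z) by ring.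
  exact: rpredB.
have [x1 px1 x0E] := pfactor_coprime p_prime x00.
rewrite x0E -iE /q -{1}(subnK (ltnW ih)) expnD !PoszM mulrAC.
rewrite dvdz_mul2r; last by rewrite eqz_nat -lt0n expn_gt0 prime_gt0.
rewrite Gauss_dvdzr; last first.
  by rewrite coprimezE /= coprime_sym coprimeXr// coprime_sym.
rewrite -eqz_mod_dvd !modz_nat eqz_nat => /eqP e.
by rewrite (divn_eq xi (p ^ (h - i))) (divn_eq xi' (p ^ (h - i))) -w1 -w2 e.
Qed.

(** Codes are counted instead of residues.  The last component ranges over the
divisors of a number determined by the other components, whence the factor [D]. *)
Lemma count_short_dual (s : seq nat) : uniq s ->
  (forall xi, xi \in s -> [/\ (xi < q)%N, ~~ (p %| xi)%N & short_dual q xi Y]) ->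
  (size s <= h * (2 * Y).+1 * 2 * (2 * R).+1 * D)%N.
Proof.
move=> us hs.
have /choice[f fP] xi : exists c, xi \in s -> encodes xi c.
  case: (boolP (xi \in s)) => [/[dup] xis /hs[]|_]; last by exists (0, 0, true, 0, 0)%N.
  by move=> a b c; have [d] := short_dual_encodes a b c; exists d.
pose idx := [seq (a, t) | a <- [seq (a, b) | a <- [seq (i, w) | i <- iota 0 h,
  w <- iota 0 (2 * Y).+1], b <- [:: true; false]], t <- iota 0 (2 * R).+1].
pose dv j := if (0 < product j <= Y ^ 2)%N then divisors (product j) else [::].
pose codes := [seq (j, x0) | j <- idx, x0 <- dv j].
apply: (@leq_trans (size codes)).
  rewrite -(size_map f); apply: uniq_leq_size.
    rewrite map_inj_in_uniq// => xi xi' xis xis' fE.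
    have [a _ _] := hs _ xis; have [a' _ _] := hs _ xis'.
    by apply: (encodes_inj a a' (fP _ xis)); rewrite fE; exact: fP.
  move=> c /mapP[xi xis ->]; have := fP _ xis.
  case: (f xi) => [[[[i w] b] t] x0] [[ih wY tR] [pr x0d] _ _].
  apply/allpairsPdep; exists (i, w, b, t), x0; split=> //; last first.
    by rewrite /dv pr -dvdn_divisors//; case/andP: pr.
  apply/allpairsP; exists ((i, w, b), t); rewrite mem_iota tR; split=> //.
  apply/allpairsP; exists ((i, w), b); split=> //; last by case: (b).
  by apply/allpairsP; exists (i, w); rewrite !mem_iota ih wY; split.
rewrite size_allpairs_dep (_ : (h * _ * _ * _)%N = size idx); last first.
  by rewrite !size_allpairs !size_iota.
rewrite sumnE big_map -sum1_size big_distrl /=; apply: leq_sum => j _.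
by rewrite mul1n /dv; case: ifP => // /divisors_le.
Qed.
End Count.
End ShortDualVectors.

(** * Transference for quadratics *)

Section Transference.
Variables (q xi : nat).
Hypothesis q_gt0 : (0 < q)%N.

Definition quad_val (a b c : int) : int := a + b * xi%:Z + c * xi%:Z ^+ 2.

Definition quad_reachable (T : nat) (y : int) : Prop := exists a b c : int,
  [/\ (`|a| <= T)%N, (`|b| <= T)%N, (`|c| <= T)%N & (q%:Z %| quad_val a b c - y)%Z].

Lemma quad_reachable_le T T' y : (T <= T')%N ->
  quad_reachable T y -> quad_reachable T' y.
Proof.
move=> TT' [a [b [c [ha hb hc d]]]]; exists a, b, c.
by split=> //; exact: leq_trans TT'.
Qed.

Lemma quad_reachable_mod T y z : (q%:Z %| y - z)%Z ->
  quad_reachable T y -> quad_reachable T z.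
Proof.
move=> yz [a [b [c [ha hb hc d]]]]; exists a, b, c; split=> //.
have -> : quad_val a b c - z = quad_val a b c - y + (y - z) by ring.
exact: rpredD.
Qed.

Lemma quad_reachableB T T' y z :
  quad_reachable T y -> quad_reachable T' z -> quad_reachable (T + T') (y - z).
Proof.
move=> [a [b [c [ha hb hc d]]]] [a' [b' [c' [ha' hb' hc' d']]]].
have tri (u v : int) : (`|u| <= T -> `|v| <= T' -> absz (u - v) <= T + T')%N.
  by clear; lia.
exists (a - a'), (b - b'), (c - c'); split; try exact: tri.
have -> : quad_val (a - a') (b - b') (c - c') - (y - z) =
  (quad_val a b c - y) - (quad_val a' b' c' - z) by rewrite /quad_val; ring.
exact: rpredB.
Qed.

Lemma quad_reachable_all T : (forall y, quad_reachable T y -> quad_reachable T (y + 1)) ->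
  forall y, quad_reachable T y.
Proof.
move=> h y; apply: (@quad_reachable_mod _ (absz (y %% q%:Z)%Z)%:Z).
  by rewrite gez0_abs ?modz_ge0 -?lt0n// -eqz_mod_dvd modz_mod.
elim: (absz _) => [|k IHk]; last by rewrite -addn1 PoszD; exact: h.
by exists 0, 0, 0; split=> //; rewrite /quad_val !mul0r !addr0 subrr dvdz0.
Qed.

(** Growth in the Cayley graph of the integers modulo [q].  Reachable sets
increase strictly at each step until they contain everything, so one can pick
[J.+1] residues, newly reached at the odd steps [1, 3, ..., 2 * J + 1].  The
translates by them of the image of the box [A1 * A2 * A3] are disjoint, because
the difference of two points of the box is reached in a single step, and there
is no room for that many. *)
Lemma quad_reachable_growth (A1 A2 A3 B J : nat) : (0 < B)%N ->
  (A1 <= B)%N -> (A2 <= B)%N -> (A3 <= B)%N ->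
  (forall a b c a' b' c' : nat, (a < A1)%N -> (b < A2)%N -> (c < A3)%N ->
    (a' < A1)%N -> (b' < A2)%N -> (c' < A3)%N ->
    (q%:Z %| quad_val (a%:Z - a'%:Z) (b%:Z - b'%:Z) (c%:Z - c'%:Z))%Z ->
    [/\ a = a', b = b' & c = c']) ->
  (q < J.+1 * (A1 * A2 * A3))%N -> forall y, quad_reachable (2 * J * B) y.
Proof.
move=> B0 A1B A2B A3B inj qJ.
apply: contrapT => /existsNP[y0 hy0].
have step (i : 'I_J.+1) : exists g, quad_reachable ((2 * i).+1 * B) g /\
    ~ quad_reachable (2 * i * B) g.
  apply: contrapT => /forallNP h; apply: hy0.
  apply: (@quad_reachable_le (2 * i * B)).
    by rewrite leq_mul2r leq_mul2l -ltnS ltn_ord !orbT.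
  apply: quad_reachable_all => y hy; apply: contrapT => hy1; apply: (h (y + 1)).
  split=> //; rewrite mulSn addnC -[1]opprK; apply: quad_reachableB => //.
  exists (-1), 0, 0; split=> //.
have [g gP] := choice step.
pose val (x : 'I_J.+1 * 'I_A1 * 'I_A2 * 'I_A3) : int :=
  let: (i, a, b, c) := x in g i + quad_val a%:Z b%:Z c%:Z.
have val_mod x x' : (q%:Z %| val x - val x')%Z -> (x.1.1.1 <= x'.1.1.1)%N -> x = x'.
  case: x x' => [[[i a] b] c] [[[i' a'] b'] c'] /= d ii'.
  have diff (A : nat) (u v : 'I_A) : (A <= B)%N -> (absz (u%:Z - v%:Z) <= B)%N.
    by have := ltn_ord u; have := ltn_ord v; clear; lia.
  have ii : i = i'.
    apply/val_inj/eqP; rewrite eqn_leq ii' leqNgt; apply/negP => /= lt_ii'.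
    apply: (gP i').2; apply: (@quad_reachable_le ((2 * i).+1 * B + B)).
      by rewrite -mulSnr leq_mul2r; apply/orP; right; clear -lt_ii'; lia.
    have box : quad_reachable B (quad_val (a'%:Z - a%:Z) (b'%:Z - b%:Z) (c'%:Z - c%:Z)).
      exists (a'%:Z - a%:Z), (b'%:Z - b%:Z), (c'%:Z - c%:Z).
      by split; [exact: diff..|rewrite subrr dvdz0].
    apply: quad_reachable_mod (quad_reachableB (gP i).1 box).
    move: d; congr (_ %| _)%Z; rewrite /quad_val; ring.
  move: d; rewrite ii /=.
  have -> : g i' + quad_val a%:Z b%:Z c%:Z - (g i' + quad_val a'%:Z b'%:Z c'%:Z) =
    quad_val (a%:Z - a'%:Z) (b%:Z - b'%:Z) (c%:Z - c'%:Z) by rewrite /quad_val; ring.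
  by case/inj => // /val_inj -> /val_inj -> /val_inj ->.
have val_inj' x x' : (q%:Z %| val x - val x')%Z -> x = x'.
  have [le_xx'|/ltnW le_x'x] := leqP x.1.1.1 x'.1.1.1; first by move=> ?; exact: val_mod.
  by rewrite -opprB rpredN => d; apply/esym; exact: val_mod.
have res_lt x : (absz (val x %% q%:Z)%Z < q)%N.
  by have := ltz_pmod (val x) (q_gt0 : 0 < q%:Z); rewrite -ltz_nat gez0_abs ?modz_ge0// -lt0n.
have : injective (fun x => Ordinal (res_lt x)).
  move=> x x' [] /(congr1 Posz); rewrite !gez0_abs ?modz_ge0 -?lt0n// => e.
  by apply: val_inj'; rewrite -eqz_mod_dvd e.
by move=> /leq_card; rewrite !card_prod !card_ord leqNgt; move: qJ; rewrite !mulnA => ->.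
Qed.

(** Two vectors orthogonal to [(1, xi, xi ^ 2)] modulo [q] have a cross product
proportional to it modulo [q], and a short one since both factors are short. *)
Lemma cross_product_eq0 Y t M (a b c a' b' c' : int) : ~ short_dual q xi Y ->
  (q%:Z %| quad_val a b c)%Z -> (q%:Z %| quad_val a' b' c')%Z ->
  (`|a| <= t)%N -> (`|b| <= t)%N -> (`|c| <= t)%N ->
  (`|a'| <= M)%N -> (`|b'| <= M)%N -> (`|c'| <= M)%N -> (2 * t * M <= Y)%N ->
  [/\ b * c' = c * b', c * a' = a * c' & a * b' = b * a'].
Proof.
move=> nY dv dv' ha hb hc ha' hb' hc' tMY.
have small (u v u' v' : int) : (`|u| <= t)%N -> (`|v| <= t)%N ->
    (`|u'| <= M)%N -> (`|v'| <= M)%N -> (absz (u * v' - v * u')%R <= Y)%N.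
  move=> hu hv hu' hv'; apply: leq_trans tMY.
  apply: leq_trans (IntDist.leqD_dist _ 0 _) _; rewrite subr0 sub0r abszN !abszM.
  by rewrite mul2n -addnn mulnDl leq_add// leq_mul.
have [xE|xn0] := eqVneq (b * c' - c * b', c * a' - a * c', a * b' - b * a') (0, 0, 0).
  by move: xE => [] /eqP + /eqP + /eqP; rewrite !subr_eq0 => /eqP ? /eqP ? /eqP.
exfalso; apply: nY; do 3 eexists; split; first exact: xn0.
- by split; apply: small.
- have -> : (b * c' - c * b') * xi%:Z - (c * a' - a * c') =
    c' * quad_val a b c - c * quad_val a' b' c' by rewrite /quad_val; ring.
  by apply: rpredB; exact: dvdz_mull.
- have -> : (b * c' - c * b') * xi%:Z ^+ 2 - (a * b' - b * a') =
    b * quad_val a' b' c' - b' * quad_val a b c by rewrite /quad_val; ring.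
  by apply: rpredB; exact: dvdz_mull.
Qed.

Lemma quad_shortest_vector : exists a b c : int, exists2 t : nat, (0 < t)%N &
  [/\ (q%:Z %| quad_val a b c)%Z,
      [/\ (`|a| <= t)%N, (`|b| <= t)%N & (`|c| <= t)%N],
      [\/ `|a|%N = t, `|b|%N = t | `|c|%N = t] &
      forall a' b' c' : int, (q%:Z %| quad_val a' b' c')%Z ->
        (`|a'| < t)%N -> (`|b'| < t)%N -> (`|c'| < t)%N ->
        [/\ a' = 0, b' = 0 & c' = 0]].
Proof.
pose P t := `[< exists a b c : int, [/\ (q%:Z %| quad_val a b c)%Z, (0 < t)%N &
  maxn `|a| (maxn `|b| `|c|) = t] >].
have exP : exists t, P t.
  exists q; apply/asboolP; exists q%:Z, 0, 0; split=> //.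
    by rewrite /quad_val !mul0r !addr0 dvdzz.
case: (ex_minnP exP) => t /asboolP[a [b [c [dv t0 mx]]]] tmin.
exists a, b, c, t => //; split=> //.
- by split; move: mx; clear; lia.
- move: mx; clear; rewrite /maxn; case: ifP => _; last by constructor 1.
  by case: ifP => _ mx; [constructor 3|constructor 2].
- move=> a' b' c' dv' ha' hb' hc'; pose t' := maxn `|a'| (maxn `|b'| `|c'|).
  have t't : (t' < t)%N by rewrite !gtn_max ha' hb' hc'.
  have : t' = 0%N.
    apply/eqP; rewrite -leqn0 leqNgt; apply/negP => t'0.
    have /tmin : P t' by apply/asboolP; exists a', b', c'.
    by rewrite leqNgt t't.
  by rewrite /t'; clear; split; lia.
Qed.

Lemma proportional_le (t : nat) (a b d d' : int) : `|a|%N = t -> (0 < t)%N ->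
  (`|b| <= t)%N -> a * d' = b * d -> (`|d'| <= `|d|)%N.
Proof.
move=> at_ t0 bt e; rewrite -(leq_pmul2l t0) -{1}at_ -abszM e abszM.
by rewrite leq_mul2r bt orbT.
Qed.

(** Let [t] be the sup norm of a shortest vector of the lattice of quadratics
vanishing at [xi].  In a box with one side [t], in the direction of a largest
coordinate of that vector, and two sides [B], about [Y / (2t)], no two points
agree modulo the lattice: by [cross_product_eq0] their difference is
proportional to the shortest vector, and the short side makes it shorter
still.  The growth lemma then applies to the [B * B * t] residues of this box,
and [2 * J * B] is at most [4 * q / Y]. *)
Lemma quad_transference Y : (0 < Y)%N -> ~ short_dual q xi Y ->
  forall y, quad_reachable (4 * q %/ Y) y.
Proof.
move=> Y0 nY.
have [a [b [c [t t0 [dv [at_ bt ct] tE tmin]]]]] := quad_shortest_vector.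
(* If the maximum is [t], all differences are shorter than the minimal norm. *)
pose B := maxn t (Y %/ (2 * t)).+1.
have tB : (t <= B)%N by rewrite leq_maxl.
have BY : (Y <= 2 * (B * t))%N.
  rewrite mulnCA; apply: ltnW; apply: leq_trans (_ : _ <= (Y %/ (2 * t)).+1 * (2 * t))%N _.
    by rewrite ltn_ceil// muln_gt0.
  by rewrite leq_mul2r leq_maxr orbT.
have B0 : (0 < B)%N by exact: leq_trans tB.
have rigid (a' b' c' : int) : (q%:Z %| quad_val a' b' c')%Z ->
    (`|a'| < B)%N -> (`|b'| < B)%N -> (`|c'| < B)%N ->
    [\/ `|a|%N = t /\ (`|a'| < t)%N, `|b|%N = t /\ (`|b'| < t)%N
      | `|c|%N = t /\ (`|c'| < t)%N] -> [/\ a' = 0, b' = 0 & c' = 0].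
  move=> dv' ha' hb' hc' hcase.
  have [Bt|Bt] := leqP B t; first by apply: tmin => //; apply: leq_trans Bt.
  have BE : B.-1 = (Y %/ (2 * t))%N by move: Bt; rewrite /B; clear; lia.
  have [e1 e2 e3] : [/\ b * c' = c * b', c * a' = a * c' & a * b' = b * a'].
    apply: (cross_product_eq0 nY dv dv' at_ bt ct (M := B.-1)); try by rewrite -ltnS prednK.
    by rewrite BE mulnC leq_trunc_div.
  case: hcase => -[nt lt].
  - apply: tmin => //; apply: leq_ltn_trans lt.
      exact: (proportional_le nt t0 bt e3).
    exact: (proportional_le nt t0 ct (esym e2)).
  - apply: tmin => //; apply: leq_ltn_trans lt.
      exact: (proportional_le nt t0 at_ (esym e3)).
    exact: (proportional_le nt t0 ct e1).
  - apply: tmin => //; apply: leq_ltn_trans lt.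
      exact: (proportional_le nt t0 at_ e2).
    exact: (proportional_le nt t0 bt (esym e1)).
pose V := (B * B * t)%N; pose J := (q %/ V)%N => y.
have V0 : (0 < V)%N by rewrite !muln_gt0 B0.
have qJ : (q < J.+1 * V)%N by rewrite ltn_ceil.
apply: (@quad_reachable_le (2 * J * B)).
  rewrite leq_divRL//; apply: (@leq_trans (2 * J * B * (2 * (B * t)))%N).
    by rewrite leq_mul2l BY orbT.
  have -> : (2 * J * B * (2 * (B * t)))%N = (4 * (J * V))%N by rewrite /V; clear; lia.
  by rewrite leq_mul2l leq_trunc_div.
have dlt (A u v : nat) : (u < A)%N -> (v < A)%N -> (absz (u%:Z - v%:Z) < A)%N.
  by clear; lia.
have deq (u v : nat) : u%:Z - v%:Z = 0 -> u = v by clear; lia.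
have fin (A1 A2 A3 : nat) : (A1 <= B)%N -> (A2 <= B)%N -> (A3 <= B)%N ->
    V = (A1 * A2 * A3)%N ->
    [\/ `|a|%N = t /\ A1 = t, `|b|%N = t /\ A2 = t | `|c|%N = t /\ A3 = t] ->
    quad_reachable (2 * J * B) y.
  move=> h1 h2 h3 VE hc; apply: (@quad_reachable_growth A1 A2 A3) => //; last by rewrite -VE.
  move=> u v w u' v' w' hu hv hw hu' hv' hw' d.
  have [||||/deq ? /deq ? /deq ?//] := rigid _ _ _ d.
  - exact: leq_trans (dlt _ _ _ hu hu') h1.
  - exact: leq_trans (dlt _ _ _ hv hv') h2.
  - exact: leq_trans (dlt _ _ _ hw hw') h3.
  - case: hc => -[nt At]; [constructor 1|constructor 2|constructor 3]; split=> //;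
    rewrite -At; exact: dlt.
case: tE => nt.
- by apply: (fin t B B) => //; [rewrite /V; clear; lia|constructor 1].
- by apply: (fin B t B) => //; [rewrite /V; clear; lia|constructor 2].
- by apply: (fin B B t) => //; constructor 3.
Qed.
End Transference.

(** * Roots of quadratics and geometric vectors *)

Section QuadraticRoots.
Variables (p : nat) (a b c : int).
Hypothesis p_prime : prime p.
Hypotheses (pa : (p%:Z %| a)%Z) (pb : (p%:Z %| b - 1)%Z).

(** Newton's step with the derivative replaced by [1], to which it is congruent
modulo [p]: [y - P(y)] improves the root by one digit. *)
Lemma quad_hensel h k (x : int) :
  ((p ^ h.+1)%:Z %| a * x ^+ 2 + b * x + c)%Z ->
  exists2 y : int, ((p ^ (h.+1 + k))%:Z %| a * y ^+ 2 + b * y + c)%Z &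
                   ((p ^ h.+1)%:Z %| y - x)%Z.
Proof.
move=> dx; elim: k => [|k [y dy yx]]; first by exists x; rewrite ?addn0// subrr dvdz0.
pose v := a * y ^+ 2 + b * y + c; exists (y - v).
  have -> : a * (y - v) ^+ 2 + b * (y - v) + c =
      v * (a * (v - 2 * y) - (b - 1)) by rewrite /v; ring.
  rewrite addnS expnSr PoszM; apply: dvdz_mul => //.
  by apply: rpredB => //; exact: dvdz_mulr.
rewrite addrAC; apply: rpredB => //; apply: dvdz_trans dy.
by rewrite dvdzE /= dvdn_exp2l// leq_addr.
Qed.

Variables (g k : nat) (alpha : int) (x : nat -> int).
Hypothesis root_alpha : ((p ^ g)%:Z %| a * alpha ^+ 2 + b * alpha + c)%Z.
Hypothesis rec_x : forall i, (i < k)%N -> a * x i.+2 + b * x i.+1 + c * x i = 0.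
Hypothesis last_x : ((p ^ g)%:Z %| x k.+1 - alpha * x k)%Z.

(** Put [f_i = x_(i+1) - alpha * x_i].  Since [alpha] is a root, the recurrence
gives [a * f_(i+1) + (b + a * alpha) * f_i = 0] modulo [p ^ g], and
[b + a * alpha] is a unit, so divisibility descends from [f_k] to all [f_i].
The coefficient [a] is divisible by [p]: this is why the condition is imposed at
the last index. *)
Lemma recurrence_geometric m : (m <= k.+1)%N ->
  ((p ^ g)%:Z %| x 0%N * alpha ^+ m - x m)%Z.
Proof.
have back j : (j <= k)%N -> ((p ^ g)%:Z %| x (k - j).+1 - alpha * x (k - j)%N)%Z.
  elim: j => [_|j IHj jk]; first by rewrite subn0.
  have := IHj (ltnW jk); rewrite -subnSK//; set i := (k - j.+1)%N => d.
  have ik : (i < k)%N by rewrite /i ltn_subrL; case: (k) jk.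
  have cop : coprimez (p ^ g)%:Z (b + a * alpha).
    rewrite coprimezE /= coprimeXl// prime_coprime//; apply/negP => pab.
    have : (p%:Z %| 1%R)%Z.
      have -> : 1 = (b + a * alpha) - (b - 1) - a * alpha by ring.
      apply: rpredB; last exact: dvdz_mulr.
      by apply: rpredB => //; rewrite dvdzE.
    by rewrite dvdzE /= dvdn1 => /eqP p1; move: p_prime; rewrite p1.
  rewrite -(Gauss_dvdzr _ cop).
  have -> : (b + a * alpha) * (x i.+1 - alpha * x i) =
     (a * x i.+2 + b * x i.+1 + c * x i) - a * (x i.+2 - alpha * x i.+1)
     - (a * alpha ^+ 2 + b * alpha + c) * x i by ring.
  rewrite rec_x// sub0r; apply: rpredB; last exact: dvdz_mulr.
  by rewrite rpredN; exact: dvdz_mull.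
elim: m => [_|m IHm mk]; first by rewrite expr0 mulr1 subrr dvdz0.
have := back (k - m)%N (leq_subr _ _); rewrite subKn// => dm.
have -> : x 0%N * alpha ^+ m.+1 - x m.+1 =
  alpha * (x 0%N * alpha ^+ m - x m) - (x m.+1 - alpha * x m) by rewrite exprS; ring.
by apply: rpredB => //; apply: dvdz_mull; exact: IHm (ltnW mk).
Qed.
End QuadraticRoots.

(** There are [X.+1 ^ k.+2] vectors with entries in [0, X], while the [k]
recurrence values and the residue of [x_(k+1) - alpha * x_k] take fewer values. *)
Lemma recurrence_pigeonhole (k X H Q : nat) (a b c alpha : int) :
  (`|a| <= H)%N -> (`|b| <= H)%N -> (`|c| <= H)%N -> (0 < Q)%N ->
  ((6 * H * X).+1 ^ k * Q < X.+1 ^ k.+2)%N ->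
  exists x : nat -> int, [/\ exists2 m, (m <= k.+1)%N & x m != 0,
    forall m, (`|x m| <= X)%N,
    forall i, (i < k)%N -> a * x i.+2 + b * x i.+1 + c * x i = 0 &
    (Q%:Z %| x k.+1 - alpha * x k)%Z].
Proof.
move=> aH bH cH Q0 card.
pose T := {ffun 'I_k.+2 -> 'I_X.+1}.
pose y (f : T) (m : nat) : int := (f (inord m) : nat)%:Z.
pose r (f : T) (i : nat) : int := a * y f i.+2 + b * y f i.+1 + c * y f i.
have yX f m : 0 <= y f m <= X%:Z by rewrite /y lez_nat /= -ltnS ltn_ord.
have rX f i : 0 <= r f i + (3 * H * X)%:Z <= (6 * H * X)%:Z.
  have term (u v : int) : (`|u| <= H)%N -> 0 <= v <= X%:Z -> - (H * X)%:Z <= u * v <= (H * X)%:Z.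
    move=> uH /andP[v0 vX]; rewrite -ler_norml normrM (ger0_norm v0) PoszM.
    by apply: ler_pM => //; rewrite -abszE lez_nat.
  move: (term _ _ aH (yX f i.+2)) (term _ _ bH (yX f i.+1)) (term _ _ cH (yX f i)).
  rewrite /r; move: (a * _) (b * _) (c * _) => u v w.
  by rewrite -!mulnA; move: (H * X)%N => HX; clear; lia.
have s_lt f : (absz ((y f k.+1 - alpha * y f k) %% Q%:Z)%Z < Q)%N.
  by rewrite -ltz_nat gez0_abs ?modz_ge0 ?ltz_pmod// -lt0n.
pose code (f : T) : {ffun 'I_k -> 'I_(6 * H * X).+1} * 'I_Q :=
  ([ffun i : 'I_k => inord (absz (r f i + (3 * H * X)%:Z))], Ordinal (s_lt f)).
have : ~ injective code.
  move=> /leq_card; rewrite card_prod !card_ffun !card_ord leqNgt => /negP; exact.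
move=> /existsNP[f /existsNP[f' /not_implyP[fE ff']]].
exists (fun m => y f m - y f' m); case: fE => fE sE; split.
- apply: contrapT => /forall2NP h; apply: ff'; apply/ffunP => i; apply/val_inj.
  have := h i; rewrite -ltnS ltn_ord /y !inord_val => -[//|/negP/negPn].
  by rewrite subr_eq0 eqz_nat => /eqP.
- by move=> m; move: (yX f m) (yX f' m); clear; lia.
- move=> i ik; move/ffunP: fE => /(_ (Ordinal ik)); rewrite !ffunE /= => /(congr1 val) /=.
  move: (rX f i) (rX f' i) => /andP[p1 p2] /andP[q1 q2].
  rewrite !inordK ?ltnS -?lez_nat ?gez0_abs//.
  move/(congr1 Posz); rewrite !gez0_abs// => /addIr; rewrite /r => e.
  by move/eqP: e; rewrite -subr_eq0 => /eqP e; rewrite -[RHS]e; ring.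
- move/(congr1 Posz): sE; rewrite !gez0_abs ?modz_ge0 -?lt0n// => /eqP.
  rewrite eqz_mod_dvd; congr (_ %| _)%Z; ring.
Qed.

Lemma recurrence_pigeonhole_card (p k u H : nat) : (0 < p)%N -> (0 < H)%N ->
  ((7 * H) ^ k <= p ^ (2 * u))%N ->
  ((6 * H * p ^ (3 * u)).+1 ^ k * p ^ (4 * u) < (p ^ (3 * u)).+1 ^ k.+2)%N.
Proof.
move=> p0 H0 hH; set X := (p ^ (3 * u))%N; have X0 : (0 < X)%N by rewrite expn_gt0 p0.
have XX : (p ^ (2 * u) * p ^ (4 * u) = X ^ 2)%N.
  by rewrite -expnD -expnM; congr (_ ^ _)%N; clear; lia.
apply: (@leq_ltn_trans (X ^ k.+2)); last by rewrite ltn_exp2r.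
rewrite -(addn2 k) expnD -XX mulnA leq_mul2r; apply/orP; right.
apply: (@leq_trans ((7 * H * X) ^ k)); last by rewrite expnMn mulnC leq_mul2l hH orbT.
case: (k) => // k'; rewrite leq_exp2r// -mulnA -mulnA (mulnDl 1 6) addnC mulnDl.
by rewrite mul1n -addn1 leq_add2l muln_gt0 H0.
Qed.

(** * Good roots in every residue class *)

Section Children.
Variable p : nat.
Hypothesis p_prime : prime p.

(** The exponents [3 * u] and [4 * u] encode the quality of approximation
[1 / 3 + 1 = 4 / 3]. *)
Definition integer_approx (n u alpha : nat) : Prop := exists x : nat -> int,
  [/\ exists2 m, (m <= n)%N & x m != 0,
      forall m, (`|x m| <= p ^ (3 * u))%N &
      forall m, (m <= n)%N -> ((p ^ (4 * u))%:Z %| x 0%N * alpha%:Z ^+ m - x m)%Z].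

(** The quadratic used is [X - (xi %% p)] plus [p] times a quadratic whose value
at [xi] is [- (xi %/ p)] modulo [p ^ h]: it vanishes at [xi] and is congruent
to [X - xi] modulo [p], so that the derivative is [1] modulo [p]. *)
Lemma approx_of_no_short_dual (n h u Y xi : nat) : (0 < h <= 4 * u)%N -> (0 < Y)%N ->
  ~ short_dual (p ^ h) xi Y ->
  ((7 * (p * (4 * p ^ h %/ Y).+1)) ^ n <= p ^ (2 * u))%N ->
  exists2 alpha, alpha = xi %[mod p ^ h] & integer_approx n.+1 u alpha.
Proof.
move=> /andP[h0 hu] Y0 nY; set T := (4 * p ^ h %/ Y)%N => HT.
have p0 : (0 < p)%N by exact: prime_gt0.
have q0 j : (0 < p ^ j)%N by rewrite expn_gt0 p0.
have [c0 [b0 [a0 [hc hb ha d]]]] := quad_transference (q0 h) Y0 nY (- (xi %/ p)%N%:Z).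
pose a : int := p%:Z * a0; pose b : int := 1 + p%:Z * b0; pose c : int := p%:Z * c0 - (xi %% p)%N%:Z.
have bound (v : int) : (`|v| <= T)%N -> (absz (p%:Z * v)%R <= p * T)%N.
  by move=> vT; rewrite abszM leq_mul2l vT orbT.
have aH : (`|a| <= p * T.+1)%N by apply: leq_trans (bound _ ha) _; rewrite leq_mul2l leqnSn orbT.
have bH : (`|b| <= p * T.+1)%N.
  by move: (bound _ hb); rewrite /b mulnS; move: (_ * b0) (p * T)%N => v w; clear -p0; lia.
have cH : (`|c| <= p * T.+1)%N.
  move: (bound _ hc) (ltn_pmod xi p0); rewrite /c mulnS.
  by move: (_ * c0) (p * T)%N (xi %% p)%N => v w z; clear; lia.
have pa : (p%:Z %| a)%Z by exact: dvdz_mulr.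
have pb : (p%:Z %| b - 1)%Z by rewrite /b addrAC subrr add0r dvdz_mulr.
have rxi : ((p ^ h.-1.+1)%:Z %| a * xi%:Z ^+ 2 + b * xi%:Z + c)%Z.
  have -> : a * xi%:Z ^+ 2 + b * xi%:Z + c =
      p%:Z * (quad_val xi c0 b0 a0 - - (xi %/ p)%N%:Z).
    have -> : c = p%:Z * c0 - (xi%:Z - (xi %/ p)%N%:Z * p%:Z).
      by rewrite /c {2}(divn_eq xi p) PoszD PoszM; ring.
    by rewrite /a /b /quad_val; ring.
  by rewrite prednK//; exact: dvdz_mull.
have [y dy yx] := quad_hensel pa pb (4 * u - h) rxi.
rewrite prednK// subnKC// in dy yx.
pose alpha := absz (y %% (p ^ (4 * u))%:Z)%Z.
have alphaE : alpha%:Z = (y %% (p ^ (4 * u))%:Z)%Z.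
  by rewrite gez0_abs// modz_ge0 -?lt0n.
have ay : ((p ^ (4 * u))%:Z %| alpha%:Z - y)%Z by rewrite -eqz_mod_dvd alphaE modz_mod.
have ra : ((p ^ (4 * u))%:Z %| a * alpha%:Z ^+ 2 + b * alpha%:Z + c)%Z.
  have -> : a * alpha%:Z ^+ 2 + b * alpha%:Z + c = a * y ^+ 2 + b * y + c +
      (alpha%:Z - y) * (a * (alpha%:Z + y) + b) by ring.
  by apply: rpredD => //; exact: dvdz_mulr.
exists alpha.
  apply/eqP; rewrite -eqz_nat -!modz_nat eqz_mod_dvd.
  have -> : alpha%:Z - xi%:Z = (alpha%:Z - y) + (y - xi%:Z) by ring.
  by apply: rpredD => //; apply: dvdz_trans ay; rewrite dvdzE /= dvdn_exp2l.
have [|x [x0 xX xrec xlast]] := recurrence_pigeonhole (k := n) (X := p ^ (3 * u)) alpha%:Z aH bH cH (q0 (4 * u)%N).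
- by apply: recurrence_pigeonhole_card => //; rewrite muln_gt0 p0.
by exists x; split=> // m mn; exact: (recurrence_geometric p_prime pa pb ra xrec xlast).
Qed.

(** With [e = 2 * e'], [N = k * e] and [H = p ^ N], the count of
[count_short_dual] for [q = H ^ 3] and [Y = H ^ 2 / p ^ e] is about
[N * q * p ^ (- 3 * e)] times a divisor factor, and the divisor bound with
exponent [4 * k] makes that factor [O(p ^ e)].  A full power [p ^ (2 * e)] is
left over, which beats [N * p ^ m.+1] when [e] is large.  The evenness of [e]
serves to halve exponents in [exists_children]. *)
Lemma few_short_dual k m L : (1 < k)%N -> exists e', [/\ (0 < e')%N, (L <= e')%N,
  (4 * m.+1 + 8 <= e')%N &
  forall s : seq nat, uniq s ->
    (forall xi, xi \in s -> [/\ (xi < p ^ (3 * (k * (2 * e'))))%N, ~~ (p %| xi)%N &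
      short_dual (p ^ (3 * (k * (2 * e')))) xi (p ^ (2 * (k * (2 * e')) - 2 * e'))]) ->
    (size s * p ^ m.+1 <= p ^ (3 * (k * (2 * e'))))%N].
Proof.
move=> k1; have k0 := ltnW k1.
have [C hC] := @divisor_bound (4 * k) ltac:(by rewrite muln_gt0).
have C0 : (0 < C)%N by have := hC 1%N isT; rewrite muln1; apply: leq_trans; rewrite expn_gt0.
(* The summand [90 * k * C] makes [p ^ e] exceed the numerical factors of the count. *)
pose e' := (L + (4 * m.+1 + 8) + 90 * k * C)%N.
have e'0 : (0 < e')%N by rewrite /e' addnAC addn_gt0 addn_gt0 orbT.
exists e'; split=> //; first by rewrite /e' -addnA leq_addr.
  by rewrite /e' -addnA addnCA leq_addr.
move=> s us hs; set e := (2 * e')%N in hs *; set N := (k * e)%N in hs *.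
have p1 := prime_gt1 p_prime; have p0 := prime_gt0 p_prime.
have q0 j : (0 < p ^ j)%N by rewrite expn_gt0 p0.
have e0 : (0 < e)%N by rewrite muln_gt0.
have eN : (2 * e <= N)%N by rewrite leq_mul2r k1 orbT.
set Y := (p ^ (2 * N - e))%N in hs; pose D := (C * p ^ e)%N.
have Yq : (Y < p ^ (3 * N))%N by rewrite ltn_exp2l//; clear -e0 eN; lia.
have hD n : (0 < n <= Y ^ 2)%N -> (size (divisors n) <= D)%N.
  move=> /andP[n0 nY]; rewrite -(@leq_exp2r _ _ (4 * k)) ?muln_gt0//.
  apply: leq_trans (hC _ n0) _; rewrite /D expnMn; apply: leq_mul.
    by rewrite -{1}(expn1 C) leq_pexp2l// muln_gt0.
  apply: leq_trans nY _; rewrite /Y -!expnM leq_exp2l//.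
  have -> : (e * (4 * k) = 4 * N)%N by rewrite /N; clear; lia.
  by clear; lia.
have := count_short_dual p_prime Yq hD us hs.
have -> : (2 * Y ^ 2 %/ p ^ (3 * N) = 2 * p ^ (N - 2 * e))%N.
  have -> : (2 * Y ^ 2 = 2 * p ^ (N - 2 * e) * p ^ (3 * N))%N.
    rewrite -mulnA -expnD /Y -expnM; congr (_ * _ ^ _)%N; clear -eN; lia.
  by rewrite mulnK.
move=> hsize; apply: (@leq_trans (90 * k * C * e * p ^ (3 * N - 2 * e) * p ^ m.+1)%N).
  rewrite leq_mul2r; apply/orP; right; apply: leq_trans hsize _.
  apply: (@leq_trans (3 * N * (3 * Y) * 2 * (5 * p ^ (N - 2 * e)) * D)%N).
    have Y0 : (0 < Y)%N by exact: q0.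
    apply: leq_mul => //; apply: leq_mul.
      by rewrite leq_mul2r leq_mul2l; apply/orP; right; apply/orP; right; clear -Y0; lia.
    by have := q0 (N - 2 * e)%N; clear; lia.
  have <- : (Y * p ^ (N - 2 * e) * p ^ e = p ^ (3 * N - 2 * e))%N.
    by rewrite /Y -!expnD; congr (_ ^ _)%N; clear -eN; lia.
  by rewrite /D /N; apply/eq_leq; ring.
have -> : (p ^ (3 * N) = p ^ (3 * N - 2 * e) * (p ^ e * p ^ e))%N.
  by rewrite -!expnD; congr (_ ^ _)%N; clear -eN; lia.
rewrite -mulnA mulnCA leq_mul2l; apply/orP; right; rewrite mulnAC leq_mul//.
  apply: (@leq_trans (p ^ (90 * k * C) * p ^ m.+1)); first by rewrite leq_mul2r ltnW ?orbT// ltn_expl.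
  by rewrite -expnD leq_exp2l// /e /e'; clear; move: (90 * k * C)%N => w; lia.
by rewrite ltnW// ltn_expl.
Qed.

(** The siblings are separated modulo [p ^ h], whereas each is the centre of a much
smaller ball of approximable points, of radius [p ^ (- 4 * u)]. *)
Definition children_of (n m h u r : nat) (s : seq nat) : Prop :=
  [/\ size s = (p ^ (h - m.+1))%N, uniq [seq (alpha %% p ^ h)%N | alpha <- s],
      forall alpha, alpha \in s -> alpha = r %[mod p ^ m] &
      forall alpha, alpha \in s -> integer_approx n u alpha].

(** Among the [p ^ (h - m)] residues modulo [p ^ h] above [r], at most a proportion
[1 / p] has a short dual vector, so [p ^ (h - m.+1)] others can be kept.  The
third inequality says that the number of children is at least
[p ^ (4 * u * t')] for [t' = 3 * k / (2 * n * k.+2)], an exponent that tends to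
the critical one as [k] grows. *)
Lemma exists_children n k m L : (2 <= n)%N -> (1 < k)%N -> (0 < m)%N -> exists h u,
  [/\ (m < h <= 4 * u)%N, (L <= u)%N,
      (3 * k * (4 * u) <= 2 * n * k.+2 * (h - m.+1))%N &
      forall r, ~~ (p %| r)%N -> exists s, children_of n.+1 m h u r s].
Proof.
move=> n2 k1 m0; have k0 := ltnW k1.
have p1 := prime_gt1 p_prime; have p0 := prime_gt0 p_prime.
have q0 j : (0 < p ^ j)%N by rewrite expn_gt0 p0.
have [e' [e'0 Le' me' few]] := few_short_dual m L k1.
set e := (2 * e')%N in few *; set N := (k * e)%N in few *.
pose h := (3 * N)%N; pose u := (n * (k * e' + e' + 4))%N.
have u2 : (2 * u = (N + e + 8) * n)%N by rewrite /u /N /e; ring.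
have eN : (2 * e <= N)%N by rewrite leq_mul2r k1 orbT.
have eNm : (m.+1 <= e)%N by rewrite /e; clear -me'; lia.
have h_le : (h <= 4 * u)%N.
  have -> : (4 * u = 2 * (N + e + 8) * n)%N by rewrite -mulnA -u2 mulnA.
  apply: (@leq_trans (2 * (N + e + 8) * 2)); last by rewrite leq_mul2l n2 orbT.
  by rewrite /h; clear; lia.
have mh : (m < h)%N by rewrite /h; clear -eNm eN; lia.
exists h, u; split.
- by rewrite mh.
- apply: leq_trans Le' _; rewrite /u; apply: leq_trans (leq_pmull _ (ltnW n2)).
  by clear; lia.
- have -> : (3 * k * (4 * u) = 2 * n * (3 * k * (N + e + 8)))%N.
    by rewrite -[(4 * u)%N]/((2 * 2) * u)%N -(mulnA 2 2 u) u2; ring.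
  rewrite -!mulnA !leq_mul2l; apply/orP; right; apply/orP; right.
  have -> : (k * (N + e + 8) = k * (k * e) + k * e + k * 8)%N by rewrite /N; ring.
  have -> : (k.+2 * (h - m.+1) = 3 * (k * (k * e)) + 6 * (k * e) - k.+2 * m.+1)%N.
    by rewrite mulnBr; congr (_ - _)%N; rewrite /h /N; clear; lia.
  have h1 : (k.+2 * m.+1 <= 2 * k * m.+1)%N by rewrite leq_mul2r; clear -k1; lia.
  have h2 : (2 * k * m.+1 + 24 * k <= 3 * (k * e))%N.
    have -> : (2 * k * m.+1 + 24 * k = k * (2 * m.+1 + 24))%N by ring.
    by rewrite mulnCA leq_mul2l; apply/orP; right; rewrite /e; clear -me'; lia.
  by clear -h1 h2; lia.
move=> r pr.
pose cand := [seq (j * p ^ m + r %% p ^ m)%N | j <- iota 0 (p ^ (h - m))].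
have pm : (0 < p ^ m)%N by exact: q0.
have candP xi : xi \in cand -> [/\ (xi < p ^ h)%N, ~~ (p %| xi)%N & xi = r %[mod p ^ m]].
  move=> /mapP[j]; rewrite mem_iota add0n => /andP[_ jlt] ->.
  have E : (j * p ^ m + r %% p ^ m = r %[mod p ^ m])%N by rewrite modnMDl modn_mod.
  split=> //.
    apply: (@leq_trans (j.+1 * p ^ m)); first by rewrite mulSnr ltn_add2l ltn_pmod.
    apply: (@leq_trans (p ^ (h - m) * p ^ m)); first by rewrite leq_mul2r jlt orbT.
    by rewrite -expnD subnK// ltnW.
  apply: contra pr => pd; rewrite /dvdn -(@modn_dvdm (p ^ m)) ?dvdn_exp// -E modn_dvdm//.
  exact: dvdn_exp.
have cand_uniq : uniq cand.
  rewrite map_inj_uniq ?iota_uniq// => j j' /addIn /eqP.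
  by rewrite eqn_pmul2r// => /eqP.
pose Y := (p ^ (2 * N - e))%N.
pose bad := [seq xi <- cand | `[< short_dual (p ^ h) xi Y >]].
pose good := [seq xi <- cand | ~~ `[< short_dual (p ^ h) xi Y >]].
have bad_le : (size bad * p ^ m.+1 <= p ^ h)%N.
  apply: few; first exact: filter_uniq.
  by move=> xi; rewrite mem_filter => /andP[/asboolP sd /candP[]].
have good_ge : (p ^ (h - m.+1) <= size good)%N.
  have sz : (size bad + size good = p ^ (h - m))%N.
    by rewrite !size_filter count_predC size_map size_iota.
  have hm : (h - m = (h - m.+1).+1)%N by rewrite subnSK.
  move: bad_le; have -> : (p ^ h = p ^ (h - m.+1) * p ^ m.+1)%N by rewrite -expnD subnK.
  rewrite leq_pmul2r// => bad_le.
  have : (2 * p ^ (h - m.+1) <= size bad + size good)%N.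
    by rewrite sz hm expnS leq_mul2r p1 orbT.
  by move: bad_le; clear; lia.
have /choice[f fP] xi : exists alpha, xi \in good ->
    alpha = xi %[mod p ^ h] /\ integer_approx n.+1 u alpha.
  case: (boolP (xi \in good)) => [|_]; last by exists 0%N.
  rewrite mem_filter => /andP[/asboolP nsd _].
  have [||alpha aE aA] := @approx_of_no_short_dual n h u Y xi _ (q0 _) nsd.
  - by rewrite h_le (leq_trans _ mh).
  - have -> : (4 * p ^ h %/ Y = 4 * p ^ (N + e))%N.
      have -> : (4 * p ^ h = 4 * p ^ (N + e) * Y)%N.
        by rewrite -mulnA -expnD; congr (_ * _ ^ _)%N; rewrite /h; clear -eN; lia.
      by rewrite mulnK// q0.
    rewrite u2 (expnM p) leq_exp2r; last exact: ltnW.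
    apply: (@leq_trans (2 ^ 6 * (p * p ^ (N + e)))).
      rewrite mulnCA [leqRHS]mulnCA leq_mul2l; apply/orP; right.
      by have := q0 (N + e)%N; move: (p ^ (N + e))%N => w; clear; lia.
    apply: (@leq_trans (p ^ 6 * (p * p ^ (N + e)))); first by rewrite leq_mul2r leq_exp2r ?p1 ?orbT.
    by rewrite -expnS -expnD leq_exp2l//; clear; lia.
  by exists alpha.
exists (map f (take (p ^ (h - m.+1)) good)).
have mem_good xi : xi \in take (p ^ (h - m.+1)) good -> xi \in good by exact: mem_take.
split.
- by rewrite size_map size_takel.
- rewrite -map_comp (_ : map _ _ = take (p ^ (h - m.+1)) good); last first.
    rewrite -[RHS]map_id; apply/eq_in_map => xi /mem_good /[dup] /fP[E _]; rewrite mem_filter => /andP[_ /candP[lt _ _]].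
    by rewrite /= E modn_small.
  by rewrite take_uniq// filter_uniq.
- move=> _ /mapP[xi /mem_good /[dup] /fP[E _] + ->].
  rewrite mem_filter => /andP[_ /candP[_ _ <-]].
  by rewrite -(@modn_dvdm (p ^ h)) ?dvdn_exp2l 1?ltnW// E modn_dvdm// dvdn_exp2l// ltnW.
- by move=> _ /mapP[xi /mem_good /fP[_ ?] ->].
Qed.
End Children.

(** * Trees of residues *)

(** Level [K] of the tree consists of integers, meant modulo [p ^ m K].  The number
[rho] stands for [p ^ (- t)], [t] being the dimension to be reached, so that
[rho ^+ j] is the weight of a residue class modulo [p ^ j]. *)
Section CantorTree.
Variables (R : realType) (p : nat) (rho : R).
Variables (m h : nat -> nat) (child : nat -> nat -> seq nat).
Hypothesis p_prime : prime p.
Hypotheses (rho_gt0 : 0 < rho) (rho_le1 : rho <= 1) (p_rho : 1 <= p%:R * rho).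
Hypotheses (m0 : m 0%N = 1%N) (mh : forall K, (m K < h K <= m K.+1)%N).
Hypothesis size_child : forall K r, ~~ (p %| r)%N ->
  size (child K r) = (p ^ (h K - (m K).+1))%N.
Hypothesis uniq_child : forall K r, ~~ (p %| r)%N ->
  uniq [seq (alpha %% p ^ h K)%N | alpha <- child K r].
Hypothesis child_mod : forall K r alpha, ~~ (p %| r)%N -> alpha \in child K r ->
  alpha = r %[mod p ^ m K].
Hypothesis mass_child : forall K, 1 <= rho ^+ m K.+1 * p%:R ^+ (h K - (m K).+1).

Fixpoint level (K : nat) : seq nat :=
  if K is K'.+1 then flatten [seq child K' r | r <- level K'] else [:: 1%N].

Let p0 : (0 < p)%N := prime_gt0 p_prime.
Let q0 j : (0 < p ^ j)%N. Proof. by rewrite expn_gt0 p0. Qed.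

Lemma m_homo : {homo m : i j / (i <= j)%N}.
Proof.
apply: homo_leq => //; first by move=> a b c; exact: leq_trans.
by move=> K; have /andP[/ltnW a b] := mh K; exact: leq_trans b.
Qed.

Lemma m_gt K : (K < m K)%N.
Proof.
elim: K => [|K IHK]; first by rewrite m0.
by have /andP[a b] := mh K; exact: leq_trans (leq_ltn_trans IHK a) b.
Qed.

Lemma level_unit K r : r \in level K -> ~~ (p %| r)%N.
Proof.
elim: K r => [|K IHK] r /=; first by rewrite inE => /eqP ->; rewrite dvdn1 neq_ltn prime_gt1 ?orbT.
move=> /flatten_mapP[s /IHK ps rs]; have E := child_mod ps rs.
apply: contra ps => pr; have pm : (p %| p ^ m K)%N by rewrite dvdn_exp// (leq_trans _ (m_gt K)).
by rewrite /dvdn -(modn_dvdm _ pm) -E modn_dvdm.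
Qed.

Lemma size_level K : size (level K.+1) = (size (level K) * p ^ (h K - (m K).+1))%N.
Proof.
rewrite /= size_flatten /shape -map_comp sumnE big_map big_seq.
rewrite (eq_bigr (fun=> p ^ (h K - (m K).+1))%N); last first.
  by move=> r /level_unit; exact: size_child.
by rewrite -big_seq big_const_seq count_predT iter_addn_0 mulnC.
Qed.

Lemma level_ancestor K L beta : (K <= L)%N -> beta \in level L ->
  exists2 alpha, alpha \in level K & beta = alpha %[mod p ^ m K].
Proof.
move=> KL; rewrite -(subnK KL); elim: (L - K)%N beta => [|d IHd] beta.
  by rewrite add0n => ?; exists beta.
rewrite addSn => /flatten_mapP[r rL betar].
have [alpha aK E] := IHd _ rL; exists alpha => //; rewrite -E.
have E' := child_mod (level_unit rL) betar.
have pm : (p ^ m K %| p ^ m (d + K))%N by rewrite dvdn_exp2l// m_homo// leq_addl.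
by rewrite -(modn_dvdm beta pm) E' modn_dvdm.
Qed.

Definition class_count (K b j : nat) : nat :=
  count (fun alpha => alpha == b %[mod p ^ j]) (level K).

(** A class modulo [p ^ j] contains [p ^ (H - j)] classes modulo [p ^ H]; for
[j > H] the truncated exponent gives the bound [1]. *)
Lemma count_residue_class (s : seq nat) (H b j : nat) :
  uniq [seq (alpha %% p ^ H)%N | alpha <- s] ->
  (count (fun alpha => alpha == b %[mod p ^ j]) s <= p ^ (H - j))%N.
Proof.
wlog jH : j / (j <= H)%N.
  move=> wl us; have [jH|Hj] := leqP j H; first exact: wl.
  have -> : (H - j = H - H)%N by rewrite subnn; apply/eqP; rewrite subn_eq0 ltnW.
  apply: leq_trans (wl H (leqnn H) us); apply: sub_count => alpha /= /eqP E.
  by rewrite -(@modn_dvdm (p ^ j) alpha) ?dvdn_exp2l 1?ltnW// E modn_dvdm// dvdn_exp2l// ltnW.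
rewrite -size_filter => us.
rewrite -(size_map (fun alpha => alpha %% p ^ H)%N).
have <- : size [seq (i * p ^ j + b %% p ^ j)%N | i <- iota 0 (p ^ (H - j))] =
  (p ^ (H - j))%N by rewrite size_map size_iota.
apply: uniq_leq_size.
  by apply: subseq_uniq (map_subseq _ (filter_subseq _ _)) us.
move=> _ /mapP[alpha + ->]; rewrite mem_filter => /andP[/eqP E _].
apply/mapP; exists ((alpha %% p ^ H) %/ p ^ j)%N.
  by rewrite mem_iota add0n ltn_divLR// -expnD subnK// ltn_pmod.
by rewrite {1}(divn_eq (alpha %% p ^ H) (p ^ j)) modn_dvdm ?dvdn_exp2l// E.
Qed.

Lemma class_count_coarse K b j : (j <= m K)%N ->
  class_count K.+1 b j = (class_count K b j * p ^ (h K - (m K).+1))%N.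
Proof.
move=> jm; rewrite /class_count /= count_flatten -map_comp sumnE big_map.
rewrite -[count _ (level K)]sumn_count sumnE big_map big_distrl /= !big_seq.
apply: eq_bigr => r rK; rewrite -(size_child K (level_unit rK)).
have E alpha : alpha \in child K r -> alpha = r %[mod p ^ j].
  move=> /(child_mod (level_unit rK)) E.
  by rewrite -(@modn_dvdm (p ^ m K) alpha) ?dvdn_exp2l// E modn_dvdm// dvdn_exp2l.
rewrite -count_predT; case: (r %% p ^ j =P b %% p ^ j)%N => rb.
  by rewrite mul1n; apply: eq_in_count => alpha /= /E ->; rewrite rb eqxx.
rewrite mul0n -(count_pred0 (child K r)); apply: eq_in_count => alpha /= /E ->.
exact/eqP.
Qed.

Lemma class_count_fine K b j : (m K <= j)%N ->
  (class_count K.+1 b j <= class_count K b (m K) * p ^ (h K - j))%N.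
Proof.
move=> mj; rewrite /class_count /= count_flatten -map_comp sumnE big_map.
rewrite -[count _ (level K)]sumn_count sumnE big_map big_distrl /= !big_seq.
apply: leq_sum => r rK.
case: (r %% p ^ m K =P b %% p ^ m K)%N => rb.
  by rewrite mul1n; apply: count_residue_class; exact: uniq_child (level_unit rK).
rewrite mul0n leqn0 -(count_pred0 (child K r)); apply/eqP/eq_in_count => alpha /= a.
apply/negP => /eqP E; case: rb.
rewrite -(child_mod (level_unit rK) a) -(@modn_dvdm (p ^ j)) ?dvdn_exp2l// E.
by rewrite modn_dvdm// dvdn_exp2l.
Qed.

Lemma class_count_le1 K b : (class_count K b (m K) <= 1)%N.
Proof.
elim: K => [|K IHK]; first by rewrite /class_count /=; case: eqP.
have /andP[mhK hmK] := mh K.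
have := @class_count_fine K b (m K.+1) (ltnW (leq_trans mhK hmK)).
by rewrite (eqP hmK) expn0 muln1 => /leq_trans; exact.
Qed.

Let p1 : 1 <= p%:R :> R. Proof. by rewrite ler1n. Qed.

Let powR_ge1 j : 1 <= p%:R ^+ j :> R. Proof. exact: exprn_ege1. Qed.

Lemma level_mass K : 1 <= p%:R * (size (level K))%:R * rho ^+ m K.
Proof.
elim: K => [|K IHK]; first by rewrite m0 /= mulr1 expr1.
have s1 : 1 <= (size (level K))%:R :> R.
  rewrite ler1n lt0n; apply: contraTneq IHK => ->.
  by rewrite mulr0 mul0r -ltNge ltr01.
rewrite size_level natrM natrX -mulrA -mulrA [_ * rho ^+ _]mulrC.
by apply: mulr_ege1 => //; apply: mulr_ege1.
Qed.

Lemma level_gt0 K : (0 < size (level K))%N.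
Proof.
rewrite lt0n; apply: contraTneq (level_mass K) => ->.
by rewrite mulr0 mul0r -ltNge ltr01.
Qed.

(** The mass distribution estimate: after division by [size (level K)], a class of
radius [p ^ (- j)] carries at most a constant times its weight.  Above
the branching scale the proportion is inherited from the previous level;
between the branching scale [m K] and the separation scale [h K] it decreases
like the radius, hence at least as fast as the weight since [p * rho >= 1];
below the separation scale a single node is left, and [mass_child] applies. *)
Lemma class_count_mass K b j : (j <= m K)%N ->
  (class_count K b j)%:R <= p%:R ^+ 2 * (size (level K))%:R * rho ^+ j.
Proof.
elim: K => [|K IHK] jm.
  apply: (@le_trans _ _ 1).
    by rewrite lern1; apply: leq_trans (count_size _ _) _.
  apply: (@le_trans _ _ (p%:R ^+ 2 * rho ^+ 1)).
    by rewrite expr2 expr1 -mulrA mulr_ege1.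
  rewrite mulr1 ler_wpM2l ?exprn_ge0// ler_wiXn2l// ?ltW//.
  by rewrite -m0.
have [jmK|mKj] := leqP j (m K).
  rewrite class_count_coarse// size_level !natrM.
  by rewrite !mulrA [leRHS]mulrAC ler_wpM2r//; exact: IHK.
have le1 := class_count_le1 K b.
have cnt := leq_trans (class_count_fine b (ltnW mKj)) (leq_mul le1 (leqnn _)).
apply: (@le_trans _ _ (p ^ (h K - j))%:R); first by rewrite ler_nat -(mul1n (p ^ _)%N).
rewrite size_level natrM natrX natrX; have /andP[mhK hmK] := mh K.
have [jh|hj] := leqP j (h K).
  have -> : p%:R ^+ (h K - (m K).+1) = p%:R ^+ (h K - j) * p%:R ^+ (j - (m K).+1) :> R.
    by rewrite -exprD; congr (_ ^+ _); clear -jh mKj; lia.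
  have -> : rho ^+ j = rho ^+ m K * (rho * rho ^+ (j - (m K).+1)).
    by rewrite -exprS -exprD; congr (_ ^+ _); clear -mKj; lia.
  rewrite -[leLHS]mulr1.
  set A := p%:R ^+ (h K - j); set B := p%:R ^+ (j - (m K).+1); set S := (size (level K))%:R.
  set D := rho ^+ (j - (m K).+1).
  have -> : p%:R ^+ 2 * (S * (A * B)) * (rho ^+ m K * (rho * D)) =
    A * ((p%:R * S * rho ^+ m K) * ((p%:R * rho) * (B * D))) by ring.
  rewrite ler_wpM2l ?exprn_ge0//; apply: mulr_ege1; first exact: level_mass.
  by apply: mulr_ege1 => //; rewrite /B /D -exprMn exprn_ege1.
have -> : (h K - j = 0)%N by apply/eqP; rewrite subn_eq0 ltnW.
rewrite expr0; apply: (@le_trans _ _ (p%:R ^+ 2 * (size (level K))%:R *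
    (rho ^+ m K.+1 * p%:R ^+ (h K - (m K).+1)))).
  apply: mulr_ege1 => //; apply: mulr_ege1 => //.
  by rewrite ler1n level_gt0.
rewrite !mulrA mulrAC ler_wpM2l ?mulr_ge0 ?exprn_ge0//.
by rewrite ler_wiXn2l// ltW.
Qed.

(** Compactness of the set of branches, in the form of Koenig's lemma: a node is
covered when finitely many classes contain all its descendants of high level. *)
Section Koenig.
Variables (b j : nat -> nat).
Hypothesis light : forall n, p%:R ^+ 2 * \sum_(k < n) rho ^+ j k < 1.

Let covered K alpha n := exists L0, forall L beta, (L0 <= L)%N -> beta \in level L ->
  beta = alpha %[mod p ^ m K] ->
  exists k, [/\ (k < n)%N, (j k <= m L)%N & beta = b k %[mod p ^ j k]].

Let uncovered K alpha := alpha \in level K /\ forall n, ~ covered K alpha n.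

(** Otherwise the classes would carry less mass than the level that they contain. *)
Let uncovered_root : uncovered 0 1.
Proof.
split=> [|n [L cov]]; first by rewrite inE.
have : (size (level L) <= \sum_(k < n | (j k <= m L)%N) class_count L (b k) (j k))%N.
  rewrite -count_predT /class_count.
  under eq_bigr do rewrite -sum1_count big_mkcond.
  rewrite exchange_big /= -sum1_count !big_seq; apply: leq_sum => beta betaL.
  have [|k [kn jk E]] := cov L beta (leqnn L) betaL.
    by have [alpha] := level_ancestor (leq0n L) betaL; rewrite inE => /eqP ->.
  by rewrite (bigD1 (Ordinal kn))//= E eqxx.
rewrite leqNgt => /negP; apply; rewrite -(ltr_nat R) natr_sum.
apply: (@le_lt_trans _ _ (p%:R ^+ 2 * (size (level L))%:R * \sum_(k < n) rho ^+ j k)).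
  rewrite big_distrr /= [leRHS](bigID (fun k : 'I_n => (j k <= m L)%N)) /=.
  rewrite -[leLHS]addr0; apply: lerD.
    by apply: ler_sum => k; exact: class_count_mass.
  by apply: sumr_ge0 => k _; rewrite !mulr_ge0 ?exprn_ge0// ltW.
by rewrite mulrAC -[ltRHS]mul1r ltr_pM2r ?light// ltr0n level_gt0.
Qed.

(** If all children were covered, finitely many classes would suffice for each of
them, hence for all of them together. *)
Let uncovered_child K alpha : uncovered K alpha ->
  exists2 alpha', uncovered K.+1 alpha' & alpha' = alpha %[mod p ^ m K].
Proof.
move=> [aK nc]; apply: contrapT => /forall2NP none.
have /choice[f fP] alpha' : exists nL : nat * nat, alpha' \in level K.+1 ->
    alpha' = alpha %[mod p ^ m K] ->
    forall L beta, (nL.2 <= L)%N -> beta \in level L -> beta = alpha' %[mod p ^ m K.+1] ->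
    exists k, [/\ (k < nL.1)%N, (j k <= m L)%N & beta = b k %[mod p ^ j k]].
  have [a'K|] := boolP (alpha' \in level K.+1); last by exists (0, 0)%N.
  have [E|nE] := pselect (alpha' = alpha %[mod p ^ m K]); last by exists (0, 0)%N.
  have [/not_andP[//|/existsNP[n /contrapT[L0 cov]]]|//] := none alpha'.
  by exists (n, L0).
pose n := \max_(a <- level K.+1) (f a).1; pose L0 := \max_(a <- level K.+1) (f a).2.
apply: (nc n); exists (maxn K.+1 L0) => L beta; rewrite geq_max => /andP[KL L0L] betaL E.
have [alpha' a'K E'] := level_ancestor KL betaL.
have pm : (p ^ m K %| p ^ m K.+1)%N by rewrite dvdn_exp2l// m_homo.
have E2 : alpha' = alpha %[mod p ^ m K] by rewrite -(modn_dvdm alpha' pm) -E' modn_dvdm.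
have LL : ((f alpha').2 <= L)%N.
  by apply: leq_trans L0L; exact: (leq_bigmax_seq (F := fun a => (f a).2)).
have [k [kn jk Ek]] := fP alpha' a'K E2 L beta LL betaL E'.
exists k; split=> //; apply: leq_trans kn _.
exact: (leq_bigmax_seq (F := fun a => (f a).1)).
Qed.

(** An infinite branch of uncovered nodes avoids every class, since a node inside a
class is covered by it alone. *)
Lemma light_classes_avoidable : exists alpha : nat -> nat,
  [/\ forall K, alpha K \in level K,
      forall K, alpha K.+1 = alpha K %[mod p ^ m K] &
      forall K k, (j k <= m K)%N -> alpha K <> b k %[mod p ^ j k]].
Proof.
have /choice[f fP] (x : nat * nat) : exists alpha', uncovered x.1 x.2 ->
    uncovered x.1.+1 alpha' /\ alpha' = x.2 %[mod p ^ m x.1].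
  have [/uncovered_child[alpha' ? ?]|] := pselect (uncovered x.1 x.2); last by exists 0%N.
  by exists alpha'.
pose alpha := fix a K := if K is K'.+1 then f (K', a K') else 1%N.
have unc K : uncovered K (alpha K).
  by elim: K => [|K /(fP (K, alpha K))[]//]; exact: uncovered_root.
exists alpha; split=> [K|K|K k jk E]; first by have [] := unc K.
  by have [] := fP (K, alpha K) (unc K).
have [_ /(_ k.+1)] := unc K; apply; exists K => L beta KL betaL EL; exists k; split=> //.
  by apply: leq_trans jk _; exact: m_homo.
by rewrite -(@modn_dvdm (p ^ m K)) ?dvdn_exp2l// EL modn_dvdm// dvdn_exp2l.
Qed.
End Koenig.
End CantorTree.

(** * Integers inside the p-adic numbers *)

Section PadicIntegers.
Import numFieldNormedType.Exports.
Variables (R : realType) (p : nat).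
Hypothesis p_prime : prime p.
Local Notation Q := (Qp R p).

Let p_gt0 : 0 < p%:R :> R. Proof. by rewrite ltr0n prime_gt0. Qed.
Let p_gt1 : 1 < p%:R :> R. Proof. by rewrite ltr1n prime_gt1. Qed.

Lemma small_expr (x e : R) : 0 <= x < 1 -> 0 < e -> exists j : nat, x ^+ j < e.
Proof.
move=> /andP[x0 x1] e0.
have /cvgrPdist_lt/(_ e e0)[j _ hj] : (fun n => x ^+ n) @ \oo --> (0 : R).
  by apply: cvg_expr; rewrite ger0_norm.
exists j; have /= := hj j (leqnn j).
by rewrite sub0r normrN ger0_norm// exprn_ge0.
Qed.

Lemma exprVn_le (i j : nat) : (i <= j)%N -> p%:R ^- j <= p%:R ^- i :> R.
Proof. by move=> ij; rewrite lef_pV2 ?posrE ?exprn_gt0// ler_weXn2l// ltW. Qed.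

Lemma Qp_abs_int_le (z : int) (j : nat) :
  (Qp_abs (z%:~R : Q) <= p%:R ^- j) = ((p ^ j)%:Z %| z)%Z.
Proof.
rewrite -ratr_int Qp_abs_ratr /padic_abs intr_eq0.
have [->|z0] := eqVneq z 0; first by rewrite dvdz0 invr_ge0 exprn_ge0 ?ltW.
rewrite numq_int denq_int logn1 sub0r dvdzE /= pfactor_dvdn ?absz_gt0//.
by rewrite -invr_expz -exprnP lef_pV2 ?posrE ?exprn_gt0// ler_eXn2l.
Qed.

Lemma Qp_abs_int_le1 (z : int) : Qp_abs (z%:~R : Q) <= 1.
Proof. by have := Qp_abs_int_le z 0; rewrite expn0 dvd1z expr0 invr1 => ->. Qed.

Lemma Qp_abs_le_add (e : R) (x y : Q) : Qp_abs x <= e -> Qp_abs y <= e -> Qp_abs (x + y) <= e.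
Proof. by move=> xe ye; apply: le_trans (Qp_abs_ultra x y) _; rewrite ge_max xe ye. Qed.

Lemma Qp_abs_le_trans (e : R) (y x z : Q) :
  Qp_abs (x - y) <= e -> Qp_abs (y - z) <= e -> Qp_abs (x - z) <= e.
Proof. by move=> xy yz; rewrite -(subrKA y); exact: Qp_abs_le_add. Qed.

Lemma Qp_abs_distC (x y : Q) : Qp_abs (x - y) = Qp_abs (y - x).
Proof. by rewrite -Qp_absN opprB. Qed.

Lemma Qp_limit_of_residues (m alpha : nat -> nat) : {homo m : i j / (i <= j)%N} ->
  (forall K, (K < m K)%N) -> (forall K, alpha K.+1 = alpha K %[mod p ^ m K]) ->
  exists l : Q, forall K, Qp_abs (l - (alpha K)%:Z%:~R) <= p%:R ^- m K.
Proof.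
move=> m_homo m_gt step; pose x K : Q := (alpha K)%:Z%:~R.
have xKL K L : (K <= L)%N -> Qp_abs (x L - x K) <= p%:R ^- m K.
  move=> KL; rewrite -(subnK KL); elim: (L - K)%N => [|d IHd].
    by rewrite subrr Qp_abs0 invr_ge0 exprn_ge0 ?ltW.
  apply: Qp_abs_le_trans IHd; rewrite addSn.
  apply: le_trans (exprVn_le (m_homo _ _ (leq_addl d K))).
  rewrite /x -rmorphB Qp_abs_int_le -eqz_mod_dvd !modz_nat eqz_nat.
  by apply/eqP; exact: step.
have [|l hl] := @Qp_complete R p x.
  move=> e e0; have [|N hN] := @small_expr p%:R^-1 e _ e0.
    by rewrite invr_ge0 ltW//= invf_lt1.
  have eN : p%:R ^- m N < e.
    by apply: le_lt_trans hN; rewrite exprVn; apply: exprVn_le; exact: ltnW.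
  exists N => i j Ni Nj; apply: le_lt_trans eN.
  by apply: (Qp_abs_le_trans (y := x N)); [|rewrite Qp_abs_distC]; exact: xKL.
exists l => K; have [|N hN] := hl (p%:R ^- m K); first by rewrite invr_gt0 exprn_gt0.
apply: (Qp_abs_le_trans (y := x (maxn K N))); last by rewrite xKL// leq_maxl.
by rewrite Qp_abs_distC ltW// hN// leq_maxr.
Qed.

Lemma padic_class (zeta : Q) (a b : nat) (j : nat) :
  Qp_abs (zeta - a%:Z%:~R) <= p%:R ^- j -> Qp_abs (zeta - b%:Z%:~R) <= p%:R ^- j ->
  a = b %[mod p ^ j].
Proof.
move=> za zb; apply/eqP; rewrite -eqz_nat -!modz_nat eqz_mod_dvd -Qp_abs_int_le rmorphB.
by apply: Qp_abs_le_trans zb; rewrite Qp_abs_distC.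
Qed.
End PadicIntegers.

(** * From integer vectors to approximations *)

Section Approximable.
Variables (R : realType) (p : nat).
Hypothesis p_prime : prime p.
Local Notation Q := (Qp R p).

Let p_gt0 : 0 < p%:R :> R. Proof. by rewrite ltr0n prime_gt0. Qed.

Lemma Qp_int_eq0 (z : int) : (z%:~R == 0 :> Q) = (z == 0).
Proof. by rewrite -Qp_abs_eq0 -ratr_int Qp_abs_ratr padic_abs_eq0 intr_eq0. Qed.

Lemma Qp_abs_expr_sub (zeta alpha : Q) (e : R) m :
  Qp_abs zeta <= 1 -> Qp_abs alpha <= 1 -> Qp_abs (zeta - alpha) <= e ->
  Qp_abs (zeta ^+ m - alpha ^+ m) <= e.
Proof.
move=> z1 a1 ze; have e0 : 0 <= e by apply: le_trans ze; exact: Qp_abs_ge0.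
have am k : Qp_abs (alpha ^+ k) <= 1.
  elim: k => [|k IHk]; first by have := Qp_abs_int_le1 R p_prime 1.
  by rewrite exprS Qp_absM mulr_ile1 ?Qp_abs_ge0.
elim: m => [|m IHm]; first by rewrite subrr Qp_abs0.
have -> : zeta ^+ m.+1 - alpha ^+ m.+1 =
  zeta * (zeta ^+ m - alpha ^+ m) + alpha ^+ m * (zeta - alpha) by rewrite !exprS; ring.
apply: Qp_abs_le_add; rewrite Qp_absM.
  by apply: le_trans IHm; rewrite -[leRHS]mul1r ler_wpM2r ?Qp_abs_ge0.
by apply: le_trans ze; rewrite -[leRHS]mul1r ler_wpM2r ?Qp_abs_ge0.
Qed.

Lemma powR_four_thirds (u : nat) : (p%:R ^+ (3 * u)) `^ (- (1 / 3) - 1) = p%:R ^- (4 * u) :> R.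
Proof.
rewrite -!powR_mulrn ?ltW// -powRrM -powRN; congr (_ `^ _).
by rewrite !natrM; field.
Qed.

(** Irrationality of [zeta] makes one of the errors nonzero: the error of
index [1] if [x_0] is nonzero, and otherwise the error at a nonzero [x_m]. *)
Lemma approximable_of_integer_approx n u alpha (zeta : Q) : (0 < n)%N ->
  integer_approx p n u alpha -> Qp_abs (zeta - alpha%:Z%:~R) <= p%:R ^- (4 * u) ->
  (forall a b : int, b != 0 -> b%:~R * zeta <> a%:~R) ->
  approximable n zeta (1 / 3) (p%:R ^+ (3 * u)).
Proof.
move=> n0 [x [[m0 m0n xm0] xX xd]] za irr.
have za1 : Qp_abs zeta <= 1.
  rewrite -(subrK alpha%:Z%:~R zeta); apply: Qp_abs_le_add; last exact: Qp_abs_int_le1.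
  by apply: le_trans za _; have := exprVn_le R p_prime (leq0n (4 * u)); rewrite expr0 invr1.
exists (fun i : 'I_n.+1 => x i); split.
  apply: bigmax_le; first by rewrite exprn_ge0 ?ltW.
  by move=> i _; rewrite -intr_norm -abszE -natrX -pmulrn ler_nat.
apply/andP; split.
  have [m mn [m1 nz]] : exists2 m, (m <= n)%N & (1 <= m)%N /\
      (x 0%N)%:~R * zeta ^+ m - (x m)%:~R != 0 :> Q.
    have [x00|x00] := eqVneq (x 0%N) 0.
      exists m0 => //; split; first by rewrite lt0n; apply: contraNneq xm0 => ->; rewrite x00.
      by rewrite x00 mul0r sub0r oppr_eq0 Qp_int_eq0.
    exists 1%N => //; split=> //; rewrite subr_eq0 expr1; apply/eqP; exact: irr.
  have mS : (m < n.+1)%N by [].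
  apply: lt_le_trans (le_bigmax_cond _ _ (_ : (1 <= Ordinal mS)%N)); last by [].
  by rewrite lt0r Qp_abs_ge0 Qp_abs_eq0 nz.
rewrite powR_four_thirds; apply: bigmax_le; first by rewrite invr_ge0 exprn_ge0// ltW.
move=> i _; have -> : (x (ord0 : 'I_n.+1))%:~R * zeta ^+ i - (x i)%:~R =
  (x 0%N)%:~R * (zeta ^+ i - (alpha%:Z%:~R) ^+ i) +
  (x 0%N * alpha%:Z ^+ i - x i)%:~R :> Q.
  by rewrite rmorphB rmorphM rmorphXn /=; ring.
apply: Qp_abs_le_add; last by rewrite Qp_abs_int_le//; apply: xd; rewrite -ltnS.
rewrite Qp_absM; apply: le_trans (Qp_abs_expr_sub i za1 (Qp_abs_int_le1 R p_prime _) za).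
by rewrite -[leRHS]mul1r ler_wpM2r ?Qp_abs_ge0 ?Qp_abs_int_le1.
Qed.
End Approximable.

(** * Covers and scales *)

Section CoverScales.
Variables (R : realType) (p : nat).
Hypothesis p_prime : prime p.
Local Notation Q := (Qp R p).

Let p_gt0 : 0 < p%:R :> R. Proof. by rewrite ltr0n prime_gt0. Qed.
Let p_gt1 : 1 < p%:R :> R. Proof. by rewrite ltr1n prime_gt1. Qed.

Lemma hausdorff_null_cover (t eta : R) (A : set Q) : hausdorff_measure t A = 0%E ->
  0 < eta -> exists U : (set Q)^nat, [/\ forall k, (diameter (U k) <= 1)%E,
    A `<=` \bigcup_k U k &
    (\sum_(0 <= k <oo) diameter_pow t (U k) < eta%:E)%E].
Proof.
move=> H0 eta0.
have : (hausdorff_premeasure t 1 A < eta%:E)%E.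
  apply: (@le_lt_trans _ _ 0%E); last by rewrite lte_fin.
  by rewrite -H0; apply: ereal_sup_ubound; exists 1 => //=; exact: ltr01.
by move=> /ereal_inf_lt[_ [U [hU AU] <-] lt]; exists U.
Qed.

Lemma small_power_neg (t e : R) : 0 < t -> 0 < e -> exists j, (p%:R `^ (- t)) ^+ j < e.
Proof.
move=> t0 e0; apply: small_expr => //; rewrite powR_ge0 powRN invf_lt1 ?powR_gt0//.
by rewrite /powR gt_eqF// expR_gt1 mulr_gt0// ln_gt0.
Qed.

(** For [d > 0] the largest [j] with [d <= p ^ (- j)] loses at most a factor [p].
For [d = 0] no such [j] is largest, and the term [e] pays for a choice of it. *)
Lemma scale_of_diameter (t t' d e : R) : 0 <= t < t' -> t' <= 1 -> 0 <= d <= 1 -> 0 < e ->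
  exists j, d <= p%:R ^- j /\ (p%:R `^ (- t')) ^+ j <= p%:R * d `^ t + e.
Proof.
move=> /andP[t0 tt'] t'1 /andP[d0 d1] e0.
have t'0 : 0 < t' by exact: le_lt_trans tt'.
have [dE|dn0] := eqVneq d 0.
  have [j hj] := small_power_neg t'0 e0.
  exists j; rewrite dE; split; first by rewrite invr_ge0 exprn_ge0 ?ltW.
  apply: ltW; apply: lt_le_trans hj _.
  by rewrite lerDr mulr_ge0 ?powR_ge0 ?ltW.
have dgt0 : 0 < d by rewrite lt_neqAle eq_sym dn0.
have [|j0 hj0] := @small_expr _ (p%:R^-1) d _ dgt0.
  by rewrite invr_ge0 ltW//= invf_lt1.
have exj : exists j, p%:R ^- j.+1 < d.
  exists j0; apply: le_lt_trans hj0; rewrite exprVn; exact: exprVn_le.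
case: (ex_minnP exj) => j hj jmin; exists j; split.
  case: j jmin {hj} => [|j] jmin; first by rewrite expr0 invr1.
  by rewrite leNgt; apply/negP => /jmin; rewrite ltnn.
apply: (@le_trans _ _ (p%:R * d `^ t)); last by rewrite lerDl ltW.
have -> : (p%:R `^ (- t')) ^+ j = (p%:R * p%:R ^- j.+1) `^ t' :> R.
  rewrite exprS invfM mulrA divff ?gt_eqF// mul1r -powR_mulrn ?powR_ge0// -powRrM mulrC.
  by rewrite mulrN -mulNr powRrM -powR_invn// ltW.
have p_ge0 := ltW p_gt0.
rewrite powRM ?invr_ge0 ?exprn_ge0//; apply: ler_pM; rewrite ?powR_ge0//.
  by rewrite -[leRHS]powRr1 ?ler_powR// ltW.
apply: (@le_trans _ _ (d `^ t')).
  by apply: ge0_ler_powR; rewrite ?nnegrE ?invr_ge0 ?exprn_ge0 ?ltW.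
rewrite /powR gt_eqF// ler_expR; apply: ler_wnM2r; last exact: ltW.
by rewrite ln_le0.
Qed.

Lemma scale_of_set (t t' e : R) (U : set Q) : 0 <= t < t' -> t' <= 1 -> 0 < e ->
  (diameter U <= 1)%E -> exists jw : nat * R, [/\ 0 <= jw.2,
    (jw.2%:E <= diameter_pow t U)%E,
    forall x y, U x -> U y -> Qp_abs (x - y) <= p%:R ^- jw.1 &
    (p%:R `^ (- t')) ^+ jw.1 <= p%:R * jw.2 + e].
Proof.
move=> tt' t'1 e0 dU1; have t'0 : 0 < t' by case/andP: tt'; exact: le_lt_trans.
rewrite /diameter_pow; case: eqP => [->|/eqP/set0P[x0 Ux0]].
  by have [j /ltW hj] := small_power_neg t'0 e0; exists (j, 0); rewrite mulr0 add0r.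
have dU0 : (0 <= diameter U)%E by apply: ereal_sup_ubound; left.
have dUfin : diameter U \is a fin_num by rewrite ge0_fin_numE// (le_lt_trans dU1)// ltry.
rewrite -(fineK dUfin) in dU0 dU1 *; set d := fine _ in dU0 dU1 *.
have [|j [dj hj]] := @scale_of_diameter t t' d e tt' t'1 _ e0.
  by rewrite -!lee_fin dU0.
exists (j, d `^ t); split=> //=; first exact: powR_ge0.
- move=> x y Ux Uy; apply: le_trans dj; rewrite -lee_fin -Qp_mdistE /d fineK//.
  by apply: ereal_sup_ubound; right; exists x, y.
Qed.
End CoverScales.

(** * The lower bound *)

Section Assembly.
Variables (R : realType) (p : nat).
Hypothesis p_prime : prime p.
Local Notation Q := (Qp R p).

Let p_gt0 : 0 < p%:R :> R. Proof. by rewrite ltr0n prime_gt0. Qed.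
Let p_gt1 : 1 < p%:R :> R. Proof. by rewrite ltr1n prime_gt1. Qed.

Definition limit_set (m : nat -> nat) (lev : nat -> seq nat) : set Q :=
  [set zeta | forall K, exists2 alpha, alpha \in lev K &
     Qp_abs (zeta - alpha%:Z%:~R) <= p%:R ^- m K].

(** A set of diameter at most [p ^ (- j)] that meets the limit set lies in the
residue class modulo [p ^ j] of a node, so sets can be replaced by classes. *)
Lemma light_sets_avoidable (rho : R) (m : nat -> nat) (lev : nat -> seq nat) :
  {homo m : i j / (i <= j)%N} -> (forall K, (K < m K)%N) ->
  (forall b j : nat -> nat, (forall N, p%:R ^+ 2 * \sum_(k < N) rho ^+ j k < 1) ->
    exists alpha : nat -> nat, [/\ forall K, alpha K \in lev K,
      forall K, alpha K.+1 = alpha K %[mod p ^ m K] &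
      forall K k, (j k <= m K)%N -> alpha K <> b k %[mod p ^ j k]]) ->
  forall (V : (set Q)^nat) (j : nat -> nat),
  (forall k x y, V k x -> V k y -> Qp_abs (x - y) <= p%:R ^- j k) ->
  (forall N, p%:R ^+ 2 * \sum_(k < N) rho ^+ j k < 1) ->
  exists2 zeta, limit_set m lev zeta & forall k, ~ V k zeta.
Proof.
move=> m_homo m_gt avoid V j Vj light.
have mj k : p%:R ^- m (j k) <= p%:R ^- j k :> R by apply: exprVn_le => //; exact: ltnW.
have /choice[b bP] k : exists b : nat, forall zeta, limit_set m lev zeta -> V k zeta ->
    Qp_abs (zeta - b%:Z%:~R) <= p%:R ^- j k.
  have [[z0 [Ez0 Vz0]]|none] := pselect (exists z0, limit_set m lev z0 /\ V k z0).
    have [alpha _ hz0] := Ez0 (j k); exists alpha => zeta _ Vz.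
    apply: (Qp_abs_le_trans (y := z0)); first exact: Vj.
    exact: le_trans hz0 (mj k).
  by exists 0%N => zeta Ez Vz; case: none; exists zeta.
have [alpha [alev step away]] := avoid b j light.
have [l hl] := @Qp_limit_of_residues R p p_prime m alpha m_homo m_gt step.
have El : limit_set m lev l by move=> K; exists (alpha K).
exists l => // k Vkl; apply: (away (j k) k); first exact: ltnW.
exact: padic_class (le_trans (hl _) (mj k)) (bP k l El Vkl).
Qed.

Lemma sum_interleave (f : nat -> R) N : (forall i, 0 <= f i) ->
  \sum_(i < N) f i <= \sum_(k < N) (f k.*2 + f k.*2.+1).
Proof.
move=> f0; have -> : \sum_(k < N) (f k.*2 + f k.*2.+1) = \sum_(i < N + N) f i.
  rewrite addnn; elim: N => [|N IHN]; first by rewrite !big_ord0.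
  by rewrite doubleS !big_ord_recr /= IHN addrA.
by rewrite big_split_ord /= lerDl sumr_ge0.
Qed.

Lemma sum_halves (e : R) N : 0 <= e -> \sum_(k < N) e / 2 ^+ k.+1 <= e.
Proof.
move=> e0; have -> : \sum_(k < N) e / 2 ^+ k.+1 = e - e / 2 ^+ N.
  elim: N => [|N IHN]; first by rewrite big_ord0 expr0 divr1 subrr.
  by rewrite big_ord_recr /= IHN exprS; field; rewrite expf_neq0.
by rewrite gerBl divr_ge0// exprn_ge0.
Qed.

(** The fractions [3 * k / (2 * n * (k + 2))] increase to [3 / (2 * n)]. *)
Lemma exponent_below (n : nat) (t : R) : (0 < n)%N -> 0 <= t < 3 / (2 * n%:R) ->
  exists2 k, (1 < k)%N & t < (3 * k)%:R / (2 * n * k.+2)%:R.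
Proof.
move=> n0 /andP[t0]; have n0R : 0 < 2 * n%:R :> R by rewrite mulr_gt0 ?ltr0n.
rewrite ltr_pdivlMr// => hlt.
have d0 : 0 < 3 - t * (2 * n%:R) by rewrite subr_gt0.
pose x := 2 * (t * (2 * n%:R)) / (3 - t * (2 * n%:R)).
have x0 : 0 <= x by rewrite divr_ge0 ?(ltW d0)// !mulr_ge0// ltW.
exists (maxn 2 (Num.bound x)); first exact: leq_maxl.
set k := maxn _ _; have : x < k%:R.
  by apply: lt_le_trans (archi_boundP x0) _; rewrite ler_nat leq_maxr.
rewrite /x ltr_pdivrMr// ltr_pdivlMr ?ltr0n ?muln_gt0 ?n0// !natrM -(addn2 k) natrD.
lra.
Qed.

(** Indexed by codes so that the rational points form a sequence of sets with at
most one element each. *)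
Definition rational_class (k : nat) : set Q :=
  [set zeta | exists a b : int, [/\ unpickle k = Some (a, b), b != 0 &
     b%:~R * zeta = a%:~R]].

Lemma rational_class_eq k x y : rational_class k x -> rational_class k y -> x = y.
Proof.
move=> [a [b [E b0 xE]]] [a' [b' [E' _ yE]]]; move: yE.
have [<- <-] : (a, b) = (a', b') by apply: Some_inj; rewrite -E -E'.
by rewrite -xE => /mulfI -> //; rewrite Qp_int_eq0.
Qed.

(** The classes obtained from a cover of small Hausdorff sum, together with those
around the rational points, are too light to exhaust the limit set; but every
irrational point of the limit set belongs to the covered set. *)
Lemma hausdorff_measure_neq0 n t : (2 <= n)%N -> 0 <= t < 3 / (2 * n%:R) ->
  hausdorff_measure t [set xi : Q | ((1 / 3 : R)%:E <= padic_lambda n.+1 xi)%E] <> 0%E.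
Proof.
move=> n2 tn H0; have n0 : (0 < n)%N by exact: ltnW.
have [k k1 tt'] := exponent_below n0 tn; have t0 : 0 <= t by case/andP: tn.
set t' := (X in t < X) in tt'; have p_ge0 := ltW p_gt0.
have den : 0 < (2 * n * k.+2)%:R :> R by rewrite ltr0n !muln_gt0 n0.
have t'1 : t' <= 1.
  rewrite /t' ler_pdivrMr// mul1r ler_nat; apply: (@leq_trans (2 * 2 * k.+2)).
    by clear; lia.
  by rewrite leq_mul2r leq_mul2l n2 orbT.
have t'0 : 0 < t' by exact: le_lt_trans tt'.
pose rho : R := p%:R `^ (- t').
have rho0 : 0 < rho by rewrite powR_gt0.
have rho_pow j : rho ^+ j = (p%:R `^ (j%:R * t'))^-1.
  by rewrite /rho powRN exprVn -powR_mulrn ?powR_ge0// -powRrM mulrC.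
have rho1 : rho <= 1.
  rewrite -(expr1 rho) rho_pow mul1r invf_le1 ?powR_gt0// -[leLHS](powRr0 p%:R).
  by apply: ler_powR; exact: ltW.
have prho : 1 <= p%:R * rho.
  rewrite -(expr1 rho) rho_pow mul1r ler_pdivlMr ?powR_gt0// mul1r.
  by rewrite -[leRHS]powRr1//; apply: ler_powR => //; exact: ltW.
(* Each level starts at the scale where the balls of the previous one end; asking
   [K <= u K] makes the approximation scales unbounded. *)
have /choice[hu huP] (mL : nat * nat) : exists hu : nat * nat, (0 < mL.1)%N ->
    [/\ (mL.1 < hu.1 <= 4 * hu.2)%N, (mL.2 <= hu.2)%N,
      (3 * k * (4 * hu.2) <= 2 * n * k.+2 * (hu.1 - mL.1.+1))%N &
      forall r, ~~ (p %| r)%N -> exists s, children_of p n.+1 mL.1 hu.1 hu.2 r s].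
  case: (posnP mL.1) => [->|mL0]; first by exists (0, 0)%N.
  by have [h [u]] := exists_children p_prime mL.2 n2 k1 mL0; exists (h, u).
pose m := fix m K := if K is K'.+1 then (4 * (hu (m K', K')).2)%N else 1%N.
pose h K := (hu (m K, K)).1; pose u K := (hu (m K, K)).2.
have mS K : m K.+1 = (4 * u K)%N by [].
have mgt0 K : (0 < m K)%N.
  elim: K => // K /(huP (m K, K))[/andP[a b] _ _ _]; rewrite mS.
  by apply: leq_trans b; exact: leq_ltn_trans a.
have hP K := huP (m K, K) (mgt0 K).
have mh K : (m K < h K <= m K.+1)%N by have [] := hP K.
have /choice[child childP] (Kr : nat * nat) : exists s, ~~ (p %| Kr.2)%N ->
    children_of p n.+1 (m Kr.1) (h Kr.1) (u Kr.1) Kr.2 s.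
  have [_|pr] := boolP (p %| Kr.2)%N; first by exists [::].
  by have [_ _ _ /(_ _ pr)[s]] := hP Kr.1; exists s.
pose ch K r := child (K, r).
have mass K : 1 <= rho ^+ m K.+1 * p%:R ^+ (h K - (m K).+1).
  have [_ _ /= ineq _] := hP K.
  rewrite rho_pow mulrC ler_pdivlMr ?powR_gt0// mul1r -powR_mulrn//.
  apply: ler_powR; first exact: ltW.
  rewrite /t' mulrA ler_pdivrMr// -!natrM ler_nat mulnC [leqRHS]mulnC.
  exact: ineq.
have sz K r : ~~ (p %| r)%N -> size (ch K r) = (p ^ (h K - (m K).+1))%N.
  by move=> /(childP (K, r))[].
have un K r : ~~ (p %| r)%N -> uniq [seq (alpha %% p ^ h K)%N | alpha <- ch K r].
  by move=> /(childP (K, r))[].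
have cm K r alpha : ~~ (p %| r)%N -> alpha \in ch K r -> alpha = r %[mod p ^ m K].
  by move=> /(childP (K, r))[_ _ + _]; exact.
pose lev := level ch.
have mhomo : {homo m : i j / (i <= j)%N} by exact: m_homo mh.
have mgt K : (K < m K)%N by apply: m_gt.
have lambda_ge zeta : limit_set m lev zeta ->
    (forall a b : int, b != 0 -> b%:~R * zeta <> a%:~R) ->
    ((1 / 3 : R)%:E <= padic_lambda n.+1 zeta)%E.
  move=> Ez irr; apply: ereal_sup_ubound; exists (1 / 3) => // B.
  pose K := Num.bound `|B|; exists (p%:R ^+ (3 * u K)).
    apply: (le_trans (ler_norm B)); apply/ltW.
    apply: (lt_le_trans (archi_boundP (normr_ge0 B))); rewrite -natrX ler_nat.
    have [_ Ku _ _] := hP K; apply: leq_trans Ku _.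
    apply: leq_trans (ltnW (ltn_expl _ (prime_gt1 p_prime))) _.
    by rewrite leq_exp2l ?prime_gt1// leq_pmull.
  have [alpha alev za] := Ez K.+1; move: alev => /flatten_mapP[r rK ar].
  have pr : ~~ (p %| r)%N by have := @level_unit p m h ch p_prime erefl mh cm K r rK.
  have [_ _ _ /(_ _ ar) appr] := childP (K, r) pr.
  by apply: (approximable_of_integer_approx p_prime _ appr za irr).
(* The total weight is at most [(p + 2) * eta], so that [p ^ 2] times it is [1 / 2]. *)
pose eta : R := (2 * (p%:R ^+ 2 * (p%:R + 2)))^-1.
have c0 : 0 < p%:R ^+ 2 * (p%:R + 2) :> R by rewrite mulr_gt0 ?exprn_gt0 ?addr_gt0.
have eta0 : 0 < eta by rewrite invr_gt0 mulr_gt0.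
have [U [dU AU sumU]] := hausdorff_null_cover H0 eta0.
pose e i : R := eta / 2 ^+ i.+1.
have e0 i : 0 < e i by rewrite divr_gt0 ?exprn_gt0.
have /choice[jw jwP] i := @scale_of_set R p p_prime t t' (e i) (U i)
  ltac:(by rewrite t0) t'1 (e0 i) (dU i).
have /choice[jq jqP] i := @small_power_neg R p p_prime t' (e i) t'0 (e0 i).
(* Even indices carry the cover and odd ones the rational points. *)
pose V i := if odd i then rational_class i./2 else U i./2.
pose j i := if odd i then jq i./2 else (jw i./2).1.
have Vj i x y : V i x -> V i y -> Qp_abs (x - y) <= p%:R ^- j i.
  rewrite /V /j; case: odd; last by have [_ _ + _] := jwP i./2; exact.
  by move=> /rational_class_eq h1 /h1 ->; rewrite subrr Qp_abs0 invr_ge0 exprn_ge0.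
have light N : p%:R ^+ 2 * \sum_(i < N) rho ^+ j i < 1.
  have sumw : \sum_(i < N) (jw i).2 <= eta.
    rewrite -lee_fin; apply: le_trans (ltW sumU); rewrite -sumEFin.
    apply: (@le_trans _ _ (\sum_(0 <= i < N) diameter_pow t (U i))%E).
      by rewrite big_mkord; apply: lee_sum => i _; have [] := jwP i.
    apply: (@nneseries_lim_ge R (fun i => diameter_pow t (U i)) xpredT 0 N) => i _ _; have [w0 wle _ _] := jwP i.
    by apply: le_trans wle; rewrite lee_fin.
  have sume : \sum_(i < N) e i <= eta by apply: sum_halves; exact: ltW.
  have bound : \sum_(i < N) rho ^+ j i <= (p%:R + 2) * eta.
    apply: (le_trans (@sum_interleave (fun i => rho ^+ j i) N _)).
      by move=> i; apply: exprn_ge0; exact: ltW.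
    apply: (@le_trans _ _ (\sum_(i < N) (p%:R * (jw i).2 + e i + e i))).
      apply: ler_sum => i _; rewrite /j odd_double /= odd_double /= doubleK uphalf_double.
      by apply: lerD; [have [] := jwP i|exact: ltW].
    rewrite !big_split /= -big_distrr /=.
    by have := ler_wpM2l p_ge0 sumw; move: sume; lra.
  apply: (@le_lt_trans _ _ (p%:R ^+ 2 * ((p%:R + 2) * eta))).
    by rewrite ler_wpM2l ?exprn_ge0.
  by rewrite mulrA /eta invfM mulrCA divff ?gt_eqF// mulr1; lra.
have [zeta Ez Vz] := light_sets_avoidable mhomo mgt
  (light_classes_avoidable p_prime rho0 rho1 prho erefl mh sz un cm mass) Vj light.
have [i _ Uz] : (\bigcup_i U i) zeta.
  apply: AU; apply: lambda_ge => // a b b0 E; apply: (Vz (pickle (a, b)).*2.+1).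
  by rewrite /V /= odd_double /= uphalf_double; exists a, b; rewrite pickleK.
by apply: (Vz i.*2); rewrite /V odd_double doubleK.
Qed.
End Assembly.

Unset Implicit Arguments.

Theorem theorem2p3 (R : realType) (p : nat) (p_prime : prime p)
    (n : nat) (n_ge3 : (3 <= n)%N) :
  ((2 / ((n%:R - 1) * (1 + 1 / 3)) : R)%:E
   <= hausdorff_dim [set xi : Qp R p | (1 / 3 : R)%:E <= padic_lambda n xi])%E.
Proof.
case: n n_ge3 => // n n2; apply: le_ereal_inf_tmp => _ [t [t0 Ht] <-].
rewrite lee_fin leNgt; apply/negP => lt.
apply: (hausdorff_measure_neq0 p_prime n2 _ Ht); rewrite t0 (lt_le_trans lt)//.
have -> : n.+1%:R - 1 = n%:R :> R by rewrite -natr1 addrK.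
have n0 : n%:R != 0 :> R by rewrite pnatr_eq0 -lt0n ltnW.
by rewrite le_eqVlt; apply/orP; left; apply/eqP; field.
Qed.
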